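(* Let $a\in(0,1)$ and let $\Gamma_a=\{e^{i\theta}: 2\arcsin(a)\le|\theta|\le\pi\}\subset\partial\mathbb{D}$. Let $\mu$ be a nontrivial probability measure on $\partial\mathbb{D}$ with Verblunsky coefficients $\{\alpha_j\}_{j=0}^\infty$, $\rho_j=(1-|\alpha_j|^2)^{1/2}$, and suppose $\mu$ is regular for $\Gamma_a$, i.e. $\sigma_{\mathrm{ess}}(\mu)=\Gamma_a$ and $\lim_{N\to\infty}\bigl(\prod_{j=0}^{N-1}\rho_j\bigr)^{1/N}=C(\Gamma_a)$, the logarithmic capacity of $\Gamma_a$. Then, as $N\to\infty$, (a) $\frac1N\sum_{j=0}^{N-1}(|\alpha_j|-a)^2\to0$; (b) $\frac1N\sum_{j=0}^{N-1}|\alpha_{j+1}-\alpha_j|^2\to0$; (c) for every positive integer $k$, $\frac1N\sum_{j=0}^{N-1}\min_{\theta}\Bigl(\sum_{m=1}^k|\alpha_{j+m}-ae^{i\theta}|^2\Bigr)\to0$.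
   Context: The Verblunsky coefficients $\alpha_j\in\mathbb{D}$ of $\mu$ are defined by the Szegő recursion $\Phi_{j+1}(z)=z\Phi_j(z)-\bar\alpha_j\Phi_j^*(z)$ for the monic orthogonal polynomials $\Phi_j$ of $\mu$, where $\Phi_j^*(z)=z^j\overline{\Phi_j(1/\bar z)}$. $\sigma_{\mathrm{ess}}(\mu)$ is the support of $\mu$ with isolated points removed. *)

(* Defs.v *)
From HB Require Import structures.
From mathcomp Require Import all_boot all_order all_algebra.
From mathcomp Require Import all_classical all_reals all_analysis.
From mathcomp Require Import complex.
Set Implicit Arguments. Unset Strict Implicit. Unset Printing Implicit Defensive.
Import Order.TTheory GRing.Theory Num.Theory numFieldNormedType.Exports.
Local Open Scope classical_set_scope.
Local Open Scope ring_scope.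

Section OPUC.
Variable R : realType.
Local Notation C := (R[i]).

Definition cnorm (z : C) : R := Num.sqrt (complex.Re z ^+ 2 + complex.Im z ^+ 2).
Definition cconj (z : C) : C := Complex (complex.Re z) (- complex.Im z).

Definition expi (t : R) : C := Complex (cos t) (sin t).

(* Phi^*_j(z) = z^j conj(Phi_j(1/conj z)) for a polynomial of degree <= j:
   the polynomial with coefficients conj(p_{j-i}). *)
Definition reversed (j : nat) (p : {poly C}) : {poly C} :=
  \poly_(i < j.+1) cconj (p`_(j - i)).

Fixpoint szego_Phi (alpha : nat -> C) (n : nat) : {poly C} :=
  match n with
  | 0%N => 1
  | j.+1 => 'X * szego_Phi alpha j
            - (cconj (alpha j))%:P * reversed j (szego_Phi alpha j)
  end.

(* A probability measure on the unit circle is represented as a probability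
   measure nu on R (the angle), mu being its pushforward by theta |-> e^{i theta}. *)
Definition cintegral (nu : probability R R) (f : R -> C) : C :=
  Complex (Rintegral nu setT (fun t => complex.Re (f t)))
          (Rintegral nu setT (fun t => complex.Im (f t))).

Definition inner (nu : probability R R) (p q : {poly C}) : C :=
  cintegral nu (fun t => p.[expi t] * cconj q.[expi t]).

(* alpha are the Verblunsky coefficients of mu: alpha_j in D and the polynomials
   generated by the Szego recursion are the monic orthogonal polynomials of mu
   (Phi_n is monic of degree n by construction; orthogonal to z^k, k < n). *)
Definition verblunsky (nu : probability R R) (alpha : nat -> C) : Prop :=
  (forall j, cnorm (alpha j) < 1) /\
  (forall n k, (k < n)%N -> inner nu (szego_Phi alpha n) ('X^k) = 0).

Definition preball (z : C) (e : R) : set R := [set t | cnorm (expi t - z) < e].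

Definition supp (nu : probability R R) : set C :=
  [set z | forall e : R, 0 < e -> (0 < nu (preball z e))%E].

Definition nontrivial (nu : probability R R) : Prop := ~ finite_set (supp nu).

Definition isolated (S : set C) (z : C) : Prop :=
  exists2 e : R, 0 < e & forall w, S w -> cnorm (w - z) < e -> w = z.

Definition ess_supp (nu : probability R R) : set C :=
  [set z | supp nu z /\ ~ isolated (supp nu) z].

Definition Gamma (a : R) : set C :=
  [set z | exists t : R, z = expi t /\ 2 * asin a <= `|t| <= pi].

Definition diam_n (K : set C) (n : nat) : R :=
  sup [set d | exists z : 'I_n -> C, (forall i, K (z i)) /\
        d = powR (\prod_(i < n) \prod_(j < n | (i < j)%N) cnorm (z i - z j))
                 (2 / (n%:R * (n%:R - 1)))].

(* logarithmic capacity, as the transfinite diameter lim_{n->oo} diam_n K *)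
Definition capacity (K : set C) : R := limn (fun n => diam_n K n.+2).

End OPUC.

(* Main.v *)
Require Import Defs.
From HB Require Import structures.
From mathcomp Require Import all_boot all_order all_algebra.
From mathcomp Require Import all_classical all_reals all_analysis.
From mathcomp Require Import perm complex ring lra zify.
Import Order.TTheory GRing.Theory Num.Theory numFieldNormedType.Exports.
Local Open Scope classical_set_scope.
Local Open Scope ring_scope.
Set Implicit Arguments. Unset Strict Implicit. Unset Printing Implicit Defensive.

(** With alpha_(-1) = -1, the Szego recursion gives, for large real r,
    ln |Phi_N(r)|^2 <= 2 N ln r + (2/r) Re sum_j conj(alpha_j) alpha_(j-1)
    + O(N / r^2).
    In the other direction, orthogonality shows that |Phi_N(r)| / ||Phi_N|| is,
    up to a constant, at least |P(r)| / ||P|| for every P of degree at most N;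
    for P we take a rescaled Chebyshev polynomial of a slightly larger arc times
    a fixed polynomial vanishing at the finitely many points of the support off
    that arc. As ||Phi_N||^2 = prod_j (1 - |alpha_j|^2), regularity and the value
    C(Gamma_a) = sqrt(1 - a^2) turn the comparison, as N and then r tend to
    infinity, into
    liminf (1/N) Re sum_j conj(alpha_(j+1)) alpha_j >= a^2.
    Since (1/N) sum_j ln(1 - |alpha_j|^2) tends to ln(1 - a^2), strict concavity
    of ln forces |alpha_j|^2 to be Cesaro-close to a^2, and all three claims
    follow by expanding squares. *)

(** Regularity controls only the geometric mean of the 1 - |alpha_j|^2, which says nothing about
    phases; a real point r outside the disc supplies a second average. The exponential rates of the
    comparison cancel: ||P||^2 is of order s^(2n) with s close to sqrt(1 - a^2), matching
    ||Phi_N||^2. What remains, per unit of N, is 2 ln(r + b) - 2 ln r against 2/r times the mean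
    correlation plus O(1/r^2), with b = 1 - s^2 near a^2, and the coefficient of 1/r is the liminf.
    So r is fixed before N grows, and is large only to hide the O(1/r^2).

    The end is a squeeze. The mean of Re conj(alpha_(j+1)) alpha_j is at most that of |alpha_j|^2 up
    to O(1/N), and concavity bounds the latter by a^2 + o(1). Near-equality in the first gives small
    increments, in the second moduli near a; a window of length k inherits both from alpha_j.

    The arc must be enlarged because isolated points of the support may accumulate at its ends. *)

Ltac ring_complex :=
  apply/eqP; rewrite eq_complex /=; apply/andP; split; apply/eqP => //=; try ring.

(** * Squared modulus, conjugation and polar form *)

Section ComplexModulus.
Variable R : realType.
Implicit Types (z w : R[i]) (r t : R).

(** Real-valued and polynomial in the coordinates, so that identities between moduli reduce to
    [ring]. *)
Definition sqnorm z : R := complex.Re z ^+ 2 + complex.Im z ^+ 2.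

Lemma sqnorm_ge0 z : 0 <= sqnorm z.
Proof. by rewrite addr_ge0 // sqr_ge0. Qed.

Lemma sqr_cnorm z : cnorm z ^+ 2 = sqnorm z.
Proof. by rewrite sqr_sqrtr // sqnorm_ge0. Qed.

Lemma cnorm_ge0 z : 0 <= cnorm z.
Proof. exact: sqrtr_ge0. Qed.

Lemma sqnorm_eq0 z : (sqnorm z == 0) = (z == 0).
Proof.
case: z => x y; rewrite /sqnorm /= paddr_eq0 ?sqr_ge0 // !sqrf_eq0.
by rewrite eq_complex.
Qed.

Lemma sqnormM z w : sqnorm (z * w) = sqnorm z * sqnorm w.
Proof. by case: z => x y; case: w => u v; rewrite /sqnorm /=; ring. Qed.

Lemma sqnorm0 : sqnorm 0 = 0.
Proof. by rewrite /sqnorm /=; ring. Qed.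

Lemma sqnorm1 : sqnorm 1 = 1.
Proof. by rewrite /sqnorm /=; ring. Qed.

Lemma sqnormN z : sqnorm (- z) = sqnorm z.
Proof. by case: z => x y; rewrite /sqnorm /=; ring. Qed.

Lemma sqnormX z n : sqnorm (z ^+ n) = sqnorm z ^+ n.
Proof. by elim: n => [|n IH]; rewrite ?expr0 ?sqnorm1 // !exprS sqnormM IH. Qed.

Lemma sqnorm_conj z : sqnorm (cconj z) = sqnorm z.
Proof. by case: z => x y; rewrite /sqnorm /=; ring. Qed.

Lemma sqnorm_prod I (s : seq I) (P : pred I) (F : I -> R[i]) :
  sqnorm (\prod_(i <- s | P i) F i) = \prod_(i <- s | P i) sqnorm (F i).
Proof. exact: (big_morph _ sqnormM sqnorm1). Qed.

Lemma sqnormD_le z w : sqnorm (z + w) <= 2 * sqnorm z + 2 * sqnorm w.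
Proof.
case: z => x y; case: w => u v; rewrite /sqnorm /= -subr_ge0.
rewrite (_ : _ - _ = (x - u) ^+ 2 + (y - v) ^+ 2); last by ring.
by rewrite addr_ge0 // sqr_ge0.
Qed.

Lemma cnormM z w : cnorm (z * w) = cnorm z * cnorm w.
Proof. by rewrite /cnorm -!/(sqnorm _) sqnormM sqrtrM // sqnorm_ge0. Qed.

Lemma cnorm_normc z : cnorm z = ComplexField.Normc.normc z. Proof. by case: z. Qed.

Lemma cnormD_le z w : cnorm (z + w) <= cnorm z + cnorm w.
Proof. by rewrite !cnorm_normc; exact: le_normcD. Qed.

Lemma cconjM z w : cconj (z * w) = cconj z * cconj w.
Proof. by case: z => x y; case: w => u v; ring_complex. Qed.

Lemma cconjD z w : cconj (z + w) = cconj z + cconj w.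
Proof. by case: z => x y; case: w => u v; ring_complex. Qed.

Lemma cconjN z : cconj (- z) = - cconj z.
Proof. by case: z => x y. Qed.

Lemma cconjK z : cconj (cconj z) = z.
Proof. by case: z => x y; rewrite /cconj /= opprK. Qed.

Lemma cconj0 : cconj 0 = 0 :> R[i].
Proof. by ring_complex. Qed.

Lemma cconj1 : cconj 1 = 1 :> R[i].
Proof. by ring_complex. Qed.

Lemma cconjX z n : cconj (z ^+ n) = cconj z ^+ n.
Proof. by elim: n => [|n IH]; rewrite ?expr0 ?cconj1 // !exprS cconjM IH. Qed.

Lemma cconj_sum I (s : seq I) (P : pred I) (F : I -> R[i]) :
  cconj (\sum_(i <- s | P i) F i) = \sum_(i <- s | P i) cconj (F i).
Proof. exact: (big_morph _ cconjD cconj0). Qed.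

Lemma mulcconj z : z * cconj z = (sqnorm z)%:C%C.
Proof. by case: z => x y; rewrite /sqnorm; ring_complex. Qed.

Lemma sqnorm_expi t : sqnorm (expi t) = 1.
Proof. by rewrite /sqnorm /expi /= cos2Dsin2. Qed.

Lemma expi_conj t : expi t * cconj (expi t) = 1.
Proof. by rewrite mulcconj sqnorm_expi. Qed.

Lemma expiD t u : expi (t + u) = expi t * expi u.
Proof. by rewrite /expi cosD sinD; congr Complex; rewrite // addrC. Qed.

Lemma expiB2pi t : expi (t - pi *+ 2) = expi t.
Proof. by rewrite /expi -(cosD2pi (t - _)) -(sinD2pi (t - _)) subrK. Qed.

Lemma exists_arg z : exists2 t, `|t| <= pi & z = (cnorm z)%:C%C * expi t.
Proof.
have [->|z0] := eqVneq z 0.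
  exists 0; first by rewrite normr0 pi_ge0.
  rewrite (_ : cnorm 0 = 0) ?mul0r//.
  by rewrite /cnorm -/(sqnorm _) sqnorm0 sqrtr0.
have n0 : cnorm z != 0.
  by rewrite -(sqrf_eq0 (cnorm z)) sqr_cnorm sqnorm_eq0.
have n_gt0 : 0 < cnorm z by rewrite lt_def n0 cnorm_ge0.
pose x := complex.Re z / cnorm z; pose y := complex.Im z / cnorm z.
have xy1 : x ^+ 2 + y ^+ 2 = 1.
  rewrite /x /y !expr_div_n -mulrDl -/(sqnorm z) sqr_cnorm divff //.
  by rewrite sqnorm_eq0.
have x1 : -1 <= x <= 1.
  rewrite -ler_norml -(@ler_pXn2r _ 2) ?nnegrE // expr1n real_normK ?num_real//.
  by rewrite -xy1 lerDl sqr_ge0.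
have cx : cos (acos x) = x by rewrite acosK.
have sy : sin (acos x) = `|y|.
  by rewrite sin_acos // -xy1 addrAC subrr add0r sqrtr_sqr.
have ax : `|acos x| <= pi by rewrite ger0_norm ?acos_ge0 ?acos_lepi.
have [y0|y0] := leP 0 y.
  exists (acos x) => //; rewrite [LHS]complexE /expi cx sy ger0_norm //.
  rewrite /x /y; case: z n0 {n_gt0 x y xy1 x1 ax cx sy y0 z0} => u v n0 /=.
  by ring_complex; field.
exists (- acos x); first by rewrite normrN.
rewrite [LHS]complexE /expi cosN sinN cx sy ltr0_norm //.
rewrite /x /y; case: z n0 {n_gt0 x y xy1 x1 ax cx sy y0 z0} => u v n0 /=.
by ring_complex; field.
Qed.

End ComplexModulus.

(** * The Szego recursion and the growth of Phi_N at large real points *)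

Section SzegoRecursion.
Variable R : realType.
Implicit Types (alpha : nat -> R[i]) (p : {poly R[i]}) (r t : R).

Lemma coef_reversed j p i :
  (reversed j p)`_i = if (i < j.+1)%N then cconj p`_(j - i) else 0.
Proof. exact: coef_poly. Qed.

Lemma size_reversed j p : (size (reversed j p) <= j.+1)%N.
Proof. exact: size_poly. Qed.

Lemma size_szego_Phi_le alpha n : (size (szego_Phi alpha n) <= n.+1)%N.
Proof.
elim: n => [|n IH] /=; first by rewrite size_poly1.
rewrite (leq_trans (size_polyD _ _)) // geq_max size_polyN; apply/andP; split.
  by rewrite (leq_trans (size_polyMleq _ _)) // size_polyX.
rewrite (leq_trans (size_polyMleq _ _)) //.
move: (size_reversed n (szego_Phi alpha n)) (size_polyC_leq1 (cconj (alpha n))).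
by move: (size _) (size _) => u v; lia.
Qed.

(** Reversal at degree j+1 turns X Phi_j into Phi_j^* and Phi_j^* into X Phi_j, exchanging the two
    terms of the recursion. *)
Lemma reversed_szego_Phi alpha j :
  reversed j.+1 (szego_Phi alpha j.+1) =
  reversed j (szego_Phi alpha j) - (alpha j)%:P * ('X * szego_Phi alpha j).
Proof.
apply/polyP => i; rewrite coef_reversed [RHS]coefB [in RHS]coefCM [in RHS]coefXM.
rewrite [in RHS]coef_reversed /= coefB coefXM coefCM coef_reversed.
have := size_szego_Phi_le alpha j; set P := szego_Phi alpha j => sP.
case: i => [|i].
  by rewrite subn0 /= ltnn mulr0 subr0 mulr0 subr0 subn0.
rewrite !ltnS subSS; case: (leqP i j) => ij /=; last first.
  rewrite (leqNgt i.+1) (leq_trans ij) //= [P`_i]nth_default ?mulr0 ?subr0//.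
  exact: leq_trans sP ij.
rewrite leq_subr (subKn ij) cconjD cconjN cconjM !cconjK.
have [->|ij'] := eqVneq i j.
  by rewrite subnn eqxx ltnn cconj0.
have {ij ij'} ij : (i < j)%N by rewrite ltn_neqAle ij' ij.
by rewrite subn_eq0 leqNgt ij /= subnS.
Qed.

(* On the unit circle, Phi^*(z) = z^j conj(Phi(z)). *)
Lemma sqnorm_reversed_expi j p t : (size p <= j.+1)%N ->
  sqnorm (reversed j p).[expi t] = sqnorm p.[expi t].
Proof.
move=> sp; have -> : (reversed j p).[expi t] = expi t ^+ j * cconj p.[expi t].
  rewrite horner_poly (horner_coef_wide _ sp) cconj_sum mulr_sumr.
  rewrite (reindex_inj rev_ord_inj) /=; apply: eq_bigr => i _.
  rewrite subSS subKn -1?ltnS // cconjM cconjX mulrCA; congr (_ * _).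
  rewrite -[X in expi t ^+ X](subnK (ltn_ord i : (i <= j)%N)) exprD -mulrA.
  by rewrite -exprMn expi_conj expr1n mulr1.
by rewrite sqnormM sqnormX sqnorm_expi expr1n mul1r sqnorm_conj.
Qed.

Lemma sqnorm_lt1 (z : R[i]) : cnorm z < 1 -> sqnorm z < 1.
Proof.
by move=> z1; rewrite -sqr_cnorm expr_lt1 // cnorm_ge0.
Qed.

Definition cross alpha (j : nat) : R :=
  complex.Re (cconj (alpha j.+1) * alpha j).

(* The convention alpha_(-1) = -1. *)
Definition alpha_pred alpha (j : nat) : R[i] :=
  if j is i.+1 then alpha i else -1.

(** The sums differ by one term at each end, both of modulus at most 1; hence the 2. *)
Lemma sum_cross_pred alpha N : (forall j, cnorm (alpha j) < 1) ->
  \sum_(j < N) complex.Re (cconj (alpha j) * alpha_pred alpha j) <=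
  2 + \sum_(j < N) cross alpha j.
Proof.
move=> a1.
have bound (z w : R[i]) : sqnorm z <= 1 -> sqnorm w <= 1 ->
    `|complex.Re (cconj z * w)| <= 1.
  move=> z1 w1; rewrite -(@ler_pXn2r _ 2) ?nnegrE // expr1n real_normK ?num_real//.
  apply: le_trans (_ : sqnorm (cconj z * w) <= 1).
    by rewrite /sqnorm lerDl sqr_ge0.
  by rewrite sqnormM sqnorm_conj mulr_ile1 // sqnorm_ge0.
have {}a1 j : sqnorm (alpha j) <= 1 by rewrite ltW // sqnorm_lt1.
case: N => [|N]; first by rewrite !big_ord0 addr0.
have -> : \sum_(j < N.+1) cross alpha j = \sum_(j < N) cross alpha j + cross alpha N.
  by rewrite big_ord_recr.
have -> : \sum_(j < N.+1) complex.Re (cconj (alpha j) * alpha_pred alpha j) =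
    complex.Re (cconj (alpha 0) * -1) + \sum_(j < N) cross alpha j.
  by rewrite big_ord_recl.
have := bound (alpha 0) (-1) (a1 _).
rewrite sqnormN sqnorm1 => /(_ (lexx _)); rewrite ler_norml => /andP[_ h1].
have := bound _ _ (a1 N.+1) (a1 N); rewrite -/(cross _ _) ler_norml => /andP[h2 _].
lra.
Qed.

(** Here x = Phi_j(r), y = Phi_j^*(r) and be = alpha_(j-1). The invariant says |y/x + be| <= 2/r, so
    x'/x = r - conj(al) y/x equals r + conj(al) be up to O(1/r), which puts the correlation into the
    exponent. *)
Lemma szego_step (r : R) (x y al be : R[i]) : 2 <= r -> sqnorm al < 1 ->
  x != 0 -> sqnorm y <= sqnorm x ->
  r ^+ 2 * sqnorm (y + be * x) <= 4 * sqnorm x ->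
  let x' := r%:C%C * x - cconj al * y in
  let y' := y - al * (r%:C%C * x) in
  [/\ x' != 0, sqnorm y' <= sqnorm x',
      r ^+ 2 * sqnorm (y' + al * x') <= 4 * sqnorm x' &
      sqnorm x' <= r ^+ 2 * sqnorm x *
        expR (2 / r * complex.Re (cconj al * be) + 5 / r ^+ 2)].
Proof.
move=> r2 al1 x0 yx hb x' y'; have r0 : 0 < r by lra.
have al0 := sqnorm_ge0 al; have y_ge0 := sqnorm_ge0 y.
have x_gt0 : 0 < sqnorm x by rewrite lt_def sqnorm_ge0 sqnorm_eq0 x0.
(* The step multiplies the difference of squared moduli of the pair (r x, y) by 1 - |al|^2, so y'
   stays dominated by x'. In [E2] the terms in r x cancel, y' + al x' = (1 - |al|^2) y, and the new
   defect is bounded by |x| while x' grows like r. *)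
have E1 : sqnorm x' - sqnorm y' = (1 - sqnorm al) * (r ^+ 2 * sqnorm x - sqnorm y).
  rewrite /x' /y' /sqnorm; case: (x) (y) (al) => [? ?] [? ?] [? ?] /=; ring.
have E2 : sqnorm (y' + al * x') = (1 - sqnorm al) ^+ 2 * sqnorm y.
  rewrite /x' /y' /sqnorm; case: (x) (y) (al) => [? ?] [? ?] [? ?] /=; ring.
have yx' : sqnorm y' <= sqnorm x'.
  rewrite -subr_ge0 E1 mulr_ge0 //; first by lra.
  rewrite subr_ge0 (le_trans yx) // ler_peMl //; first exact: sqnorm_ge0.
  by rewrite expr_ge1 //; lra.
have lower : (r - 1) ^+ 2 * sqnorm x <= sqnorm x'.
  rewrite -!sqr_cnorm -exprMn ler_pXn2r ?nnegrE ?mulr_ge0 ?cnorm_ge0//; last lra.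
  have : cnorm (r%:C%C * x) <= cnorm x' + cnorm (cconj al * y).
    by rewrite (le_trans _ (cnormD_le _ _)) // /x' subrK.
  have -> : cnorm (r%:C%C * x) = r * cnorm x.
    rewrite cnormM; congr (_ * _).
    by rewrite /cnorm /= expr0n /= addr0 sqrtr_sqr ger0_norm // ltW.
  have : cnorm (cconj al * y) <= cnorm x; last by lra.
  rewrite -(@ler_pXn2r _ 2) ?nnegrE ?cnorm_ge0// !sqr_cnorm sqnormM sqnorm_conj.
  by rewrite (le_trans _ yx) // ler_piMl // ltW.
have x'_gt0 : 0 < sqnorm x'.
  by apply: lt_le_trans lower; rewrite mulr_gt0 // exprn_gt0 //; lra.
split => //.
- by rewrite -sqnorm_eq0 gt_eqF.
(* The constant 4 comes from r <= 2 (r - 1), valid from r = 2 on. *)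
- rewrite E2; apply: le_trans (_ : 4 * ((r - 1) ^+ 2 * sqnorm x) <= _); last first.
    by rewrite ler_pM2l.
  have h1 : 0 <= (1 - sqnorm al) ^+ 2 <= 1.
    by rewrite sqr_ge0 /= expr_le1 //; lra.
  have h2 : 0 <= r ^+ 2 <= 4 * (r - 1) ^+ 2 by rewrite sqr_ge0 /=; nra.
  move: h1 h2; move: (_ ^+ 2) (_ ^+ 2) ((r - 1) ^+ 2) => u v w /andP[u0 u1] /andP[v0 v1].
  rewrite !mulrA; apply: ler_pM => //; first exact: mulr_ge0.
  by rewrite (le_trans _ v1) // ler_piMr.
- set u := complex.Re (cconj al * be).
  set w := y + be * x.
  have E : sqnorm x' = r ^+ 2 * sqnorm x + 2 * r * u * sqnorm x
      - 2 * r * complex.Re (cconj al * w * cconj x) + sqnorm al * sqnorm y.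
    rewrite /x' /u /w /sqnorm.
    by case: (x) (y) (al) (be) => [? ?] [? ?] [? ?] [? ?] /=; ring.
  (* Completing the square bounds the third term of [E] by 2 |x|^2 plus half of the left side of
     [G], in all 4 |x|^2; the last term of [E] adds |x|^2, hence the 5. *)
  have F : 0 <= r ^+ 2 * sqnorm (cconj al * w) / 2
      + 2 * r * complex.Re (cconj al * w * cconj x) + 2 * sqnorm x.
    have := sqnorm_ge0 (r%:C%C * (cconj al * w) + 2%:C%C * x).
    move: (cconj al * w) => v; rewrite /sqnorm.
    by case: (x) v => [? ?] [? ?] /=; lra.
  have G : r ^+ 2 * sqnorm (cconj al * w) <= 4 * sqnorm x.
    rewrite sqnormM sqnorm_conj mulrCA (le_trans _ hb) // ler_piMl //; last exact: ltW.
    by rewrite mulr_ge0 ?sqr_ge0 ?sqnorm_ge0.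
  have H : sqnorm al * sqnorm y <= sqnorm x by rewrite (le_trans _ yx) // ler_piMl // ltW.
  apply: le_trans (_ : r ^+ 2 * sqnorm x * (1 + (2 / r * u + 5 / r ^+ 2)) <= _); last first.
    by rewrite ler_pM2l ?expR_ge1Dx // mulr_gt0 // exprn_gt0.
  rewrite (_ : r ^+ 2 * _ * _ = r ^+ 2 * sqnorm x + 2 * r * u * sqnorm x + 5 * sqnorm x).
    lra.
  by field; rewrite gt_eqF.
Qed.

Lemma szego_Phi_upper alpha r N : (forall j, cnorm (alpha j) < 1) -> 2 <= r ->
  let x := (szego_Phi alpha N).[r%:C%C] in
  0 < sqnorm x /\
  sqnorm x <= r ^+ (2 * N) *
     expR (2 / r * (2 + \sum_(j < N) cross alpha j) + 5 / r ^+ 2 * N%:R).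
Proof.
move=> a1 r2 x; have r0 : 0 < r by lra.
(* The induction must carry the domination of Phi_N^* by Phi_N and the approximation of their
   quotient along with the growth bound. *)
suff [x0 _ _ hx] : [/\ x != 0,
    sqnorm (reversed N (szego_Phi alpha N)).[r%:C%C] <= sqnorm x,
    r ^+ 2 * sqnorm ((reversed N (szego_Phi alpha N)).[r%:C%C] + alpha_pred alpha N * x)
      <= 4 * sqnorm x &
    sqnorm x <= r ^+ (2 * N) * expR (2 / r *
      (\sum_(j < N) complex.Re (cconj (alpha j) * alpha_pred alpha j)) + 5 / r ^+ 2 * N%:R)].
  split; first by rewrite lt_def sqnorm_ge0 sqnorm_eq0 x0.
  apply: le_trans hx _; rewrite ler_pM2l ?exprn_gt0// ler_expR lerD2r.
  by rewrite ler_pM2l ?sum_cross_pred// divr_gt0.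
rewrite {}/x; elim: N => [|N [x0 yx hb hx]].
  have -> : reversed 0 (szego_Phi alpha 0) = 1.
    apply/polyP => i; rewrite coef_reversed /= !coef1.
    by case: i => [|i] //=; rewrite cconj1.
  (* With alpha_(-1) = -1 the defect vanishes at N = 0, as Phi_0 = Phi_0^* = 1. *)
  rewrite /= hornerC sqnorm1 mulN1r subrr sqnorm0 big_ord0 !mulr0 addr0 expR0.
  by split; rewrite ?oner_eq0 // mulr1.
have := szego_step r2 (sqnorm_lt1 (a1 N)) x0 yx hb.
have -> : (reversed N.+1 (szego_Phi alpha N.+1)).[r%:C%C] =
  (reversed N (szego_Phi alpha N)).[r%:C%C]
     - alpha N * (r%:C%C * (szego_Phi alpha N).[r%:C%C]).
  by rewrite reversed_szego_Phi !hornerE.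
have -> : (szego_Phi alpha N.+1).[r%:C%C] =
  r%:C%C * (szego_Phi alpha N).[r%:C%C]
     - cconj (alpha N) * (reversed N (szego_Phi alpha N)).[r%:C%C].
  by rewrite /= !hornerE.
move=> /= [h1 h2 h3 h4]; split => //.
apply: le_trans h4 _.
rewrite big_ord_recr /=; set S := \sum_(j < N) _; set u := complex.Re _.
have -> : 2 / r * (S + u) + 5 / r ^+ 2 * N.+1%:R =
    2 / r * S + 5 / r ^+ 2 * N%:R + (2 / r * u + 5 / r ^+ 2).
  by rewrite -natr1; ring.
rewrite [in leRHS]expRD [leRHS]mulrA ler_pM2r ?expR_gt0//.
rewrite mulnS.
by rewrite exprD -mulrA ler_pM2l // exprn_gt0.
Qed.

End SzegoRecursion.

(** * Integrals over the circle, norms of Phi_N and the extremal lower bound at r *)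

Section CircleIntegrals.
Variables (R : realType) (nu : probability R R).
Implicit Types (f g : R -> R) (F G : R -> R[i]) (p q : {poly R[i]}).

(** All integrands are polynomials in cos and sin; this class is closed under ring operations and,
    the measure being finite, consists of integrable functions. *)
Definition bounded_measurable f :=
  measurable_fun [set: R] f /\ exists M : R, forall t, `|f t| <= M.

Lemma bounded_measurable_cst c : bounded_measurable (fun=> c).
Proof. by split; [exact: measurable_cst|exists `|c|]. Qed.

Lemma bounded_measurableD f g : bounded_measurable f -> bounded_measurable g ->
  bounded_measurable (fun t => f t + g t).
Proof.
move=> [mf [M fM]] [mg [K gK]]; split; first exact: measurable_realfun.measurable_funD.
by exists (M + K) => t; rewrite (le_trans (ler_normD _ _)) // lerD.
Qed.

Lemma bounded_measurableM f g : bounded_measurable f -> bounded_measurable g ->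
  bounded_measurable (fun t => f t * g t).
Proof.
move=> [mf [M fM]] [mg [K gK]]; split; first exact: measurable_realfun.measurable_funM.
by exists (M * K) => t; rewrite normrM ler_pM.
Qed.

Lemma bounded_measurableB f g : bounded_measurable f -> bounded_measurable g ->
  bounded_measurable (fun t => f t - g t).
Proof.
move=> hf hg; have := bounded_measurableD hf (bounded_measurableM (bounded_measurable_cst (-1)) hg).
by under [X in bounded_measurable X -> _]eq_fun do rewrite mulN1r.
Qed.

Lemma bounded_measurable_integrable f : bounded_measurable f ->
  nu.-integrable setT (EFin \o f).
Proof.
move=> [mf [M fM]]; apply: measurable_bounded_integrable => //.
  by apply: le_lt_trans (probability_le1 nu _) (ltry _).
exists M; split; first exact: num_real.
by move=> x Mx t _ /=; rewrite (le_trans (fM t)) // ltW.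
Qed.

Let int f := Rintegral nu setT f.

Lemma int_add f g : bounded_measurable f -> bounded_measurable g ->
  int (fun t => f t + g t) = int f + int g.
Proof. by move=> hf hg; apply: RintegralD => //; exact: bounded_measurable_integrable. Qed.

Lemma int_sub f g : bounded_measurable f -> bounded_measurable g ->
  int (fun t => f t - g t) = int f - int g.
Proof. by move=> hf hg; apply: RintegralB => //; exact: bounded_measurable_integrable. Qed.

Lemma int_scale c f : bounded_measurable f ->
  int (fun t => c * f t) = c * int f.
Proof. by move=> hf; apply: RintegralZl => //; exact: bounded_measurable_integrable. Qed.

Lemma int_le f g : bounded_measurable f -> bounded_measurable g ->
  (forall t, f t <= g t) -> int f <= int g.
Proof. by move=> hf hg fg; apply: le_Rintegral => //; exact: bounded_measurable_integrable. Qed.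

Lemma int_cst c : int (fun=> c) = c.
Proof.
rewrite /int Rintegral_cst // -[RHS]mulr1; congr (_ * _).
by rewrite -[RHS]/(fine 1%E); congr fine; exact: probability_setT.
Qed.

Lemma int_le_ae f c : bounded_measurable f -> (forall t, 0 <= f t) -> 0 <= c ->
  {ae nu, forall t, f t <= c} -> int f <= c.
Proof.
move=> hf f0 c0 fc; have := hf => -[mf _].
rewrite -[leRHS]int_cst /int /Rintegral fine_le //.
- exact/integrable_fin_num/bounded_measurable_integrable.
- exact/integrable_fin_num/bounded_measurable_integrable/bounded_measurable_cst.
apply: ae_ge0_le_integral => //.
- by move=> t _; rewrite lee_fin.
- exact/measurable_realfun.measurable_EFinP.
- by apply: filterS fc => t h _ /=; rewrite lee_fin.
Qed.

Definition cbounded_measurable F :=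
  bounded_measurable (fun t => complex.Re (F t)) /\
  bounded_measurable (fun t => complex.Im (F t)).

Lemma cbounded_measurable_cst c : cbounded_measurable (fun=> c).
Proof. by split; exact: bounded_measurable_cst. Qed.

Lemma cbounded_measurableD F G : cbounded_measurable F -> cbounded_measurable G ->
  cbounded_measurable (fun t => F t + G t).
Proof.
move=> [F1 F2] [G1 G2]; split.
  have := bounded_measurableD F1 G1; congr (bounded_measurable _).
  by apply/funext => t; case: (F t) (G t) => [? ?] [].
have := bounded_measurableD F2 G2; congr (bounded_measurable _).
by apply/funext => t; case: (F t) (G t) => [? ?] [].
Qed.

Lemma cbounded_measurableM F G : cbounded_measurable F -> cbounded_measurable G ->
  cbounded_measurable (fun t => F t * G t).
Proof.
move=> [F1 F2] [G1 G2]; split.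
  have := bounded_measurableB (bounded_measurableM F1 G1) (bounded_measurableM F2 G2).
  congr (bounded_measurable _).
  by apply/funext => t; case: (F t) (G t) => [? ?] [].
have := bounded_measurableD (bounded_measurableM F1 G2) (bounded_measurableM F2 G1).
congr (bounded_measurable _).
by apply/funext => t; case: (F t) (G t) => [? ?] [].
Qed.

Lemma cbounded_measurable_conj F : cbounded_measurable F ->
  cbounded_measurable (fun t => cconj (F t)).
Proof.
move=> [F1 F2]; split => //.
have := bounded_measurableM (bounded_measurable_cst (-1)) F2.
congr (bounded_measurable _).
by apply/funext => t; rewrite mulN1r.
Qed.

Lemma cbounded_measurable_expi : cbounded_measurable (@expi R).
Proof.
split; split.
- by apply: (@measurable_realfun.continuous_measurable_fun _ (@cos R)); exact: continuous_cos.
- by exists 1 => t; exact: cos_max.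
- by apply: (@measurable_realfun.continuous_measurable_fun _ (@sin R)); exact: continuous_sin.
- by exists 1 => t; exact: sin_max.
Qed.

Lemma cbounded_measurable_horner p : cbounded_measurable (fun t => p.[expi t]).
Proof.
elim/poly_ind: p => [|p c IH].
  under eq_fun do rewrite horner0; exact: cbounded_measurable_cst.
under eq_fun do rewrite hornerMXaddC.
apply: cbounded_measurableD; last exact: cbounded_measurable_cst.
apply: cbounded_measurableM => //; exact: cbounded_measurable_expi.
Qed.

Lemma bounded_measurable_sqnorm F : cbounded_measurable F ->
  bounded_measurable (fun t => sqnorm (F t)).
Proof. by move=> [F1 F2]; apply: bounded_measurableD; exact: bounded_measurableM. Qed.

Lemma cintegralD F G : cbounded_measurable F -> cbounded_measurable G ->
  cintegral nu (fun t => F t + G t) = cintegral nu F + cintegral nu G.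
Proof.
move=> [F1 F2] [G1 G2]; rewrite /cintegral.
transitivity (Complex (int (fun t => complex.Re (F t) + complex.Re (G t)))
                      (int (fun t => complex.Im (F t) + complex.Im (G t)))).
  congr Complex; congr (Rintegral _ _ _); apply/funext => t;
  by case: (F t) (G t) => [? ?] [].
by rewrite !int_add.
Qed.

Lemma cintegralZ c F : cbounded_measurable F ->
  cintegral nu (fun t => c * F t) = c * cintegral nu F.
Proof.
move=> [F1 F2]; rewrite /cintegral; case: c => x y.
transitivity (Complex (int (fun t => x * complex.Re (F t) - y * complex.Im (F t)))
                      (int (fun t => x * complex.Im (F t) + y * complex.Re (F t)))).
  congr Complex; congr (Rintegral _ _ _); apply/funext => t; by case: (F t).
have bc := bounded_measurable_cst.
by rewrite int_sub ?int_add ?int_scale //; apply: bounded_measurableM.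
Qed.

Lemma cintegral0 : cintegral nu (fun=> 0) = 0.
Proof. by rewrite /cintegral -!/(int _) !int_cst. Qed.

Section Orthogonality.
Variable alpha : nat -> R[i].
Hypothesis orth : verblunsky nu alpha.
Let Phi := szego_Phi alpha.

Lemma szego_orthogonal n p : (size p <= n)%N ->
  cintegral nu (fun t => (Phi n).[expi t] * cconj p.[expi t]) = 0.
Proof.
move=> pn.
have hP m := cbounded_measurable_horner m.
have hbm m (c : nat -> R[i]) : cbounded_measurable (fun t =>
    (Phi n).[expi t] * cconj (\sum_(i < m) c i * expi t ^+ i)).
  apply: cbounded_measurableM => //; apply: cbounded_measurable_conj.
  have := hP (\poly_(i < m) c i); congr cbounded_measurable.
  by apply/funext => t; rewrite horner_poly.
have -> : (fun t => (Phi n).[expi t] * cconj p.[expi t]) =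
    (fun t => (Phi n).[expi t] * cconj (\sum_(i < n) p`_i * expi t ^+ i)).
  by apply/funext => t; rewrite (horner_coef_wide _ pn).
suff H m : (m <= n)%N -> cintegral nu (fun t =>
    (Phi n).[expi t] * cconj (\sum_(i < m) p`_i * expi t ^+ i)) = 0 by exact: H.
elim: m => [_|m IH mn].
  rewrite -[RHS]cintegral0; congr cintegral; apply/funext => t.
  by rewrite big_ord0 cconj0 mulr0.
have -> : (fun t => (Phi n).[expi t] * cconj (\sum_(i < m.+1) p`_i * expi t ^+ i)) =
  (fun t => (Phi n).[expi t] * cconj (\sum_(i < m) p`_i * expi t ^+ i)
     + cconj p`_m * ((Phi n).[expi t] * cconj ('X^m).[expi t])).
  apply/funext => t; rewrite big_ord_recr /= cconjD cconjM mulrDr hornerXn.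
  by rewrite [in X in _ + X]mulrCA.
have hXm : cbounded_measurable (fun t => (Phi n).[expi t] * cconj ('X^m).[expi t]).
  by apply: cbounded_measurableM => //; exact: cbounded_measurable_conj.
rewrite cintegralD ?cintegralZ ?IH //; last first.
  by apply: cbounded_measurableM => //; exact: cbounded_measurable_cst.
  exact: ltnW.
by have := orth.2 _ _ mn; rewrite /inner => ->; rewrite mulr0 addr0.
Qed.

Definition sqnorm2 p : R := int (fun t => sqnorm p.[expi t]).

Lemma bounded_measurable_horner p : bounded_measurable (fun t => sqnorm p.[expi t]).
Proof. exact/bounded_measurable_sqnorm/cbounded_measurable_horner. Qed.

(** Pythagoras in X Phi_n = Phi_(n+1) + conj(alpha_n) Phi_n^*: the last polynomial has degree at
    most n, hence is orthogonal to Phi_(n+1), and X Phi_n, Phi_n^*, Phi_n have equal modulus on the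
    circle. *)
Lemma sqnorm2_szego n : sqnorm2 (Phi n) = \prod_(j < n) (1 - sqnorm (alpha j)).
Proof.
elim: n => [|n IH].
  rewrite big_ord0 /sqnorm2 -[RHS]int_cst; congr (Rintegral _ _ _).
  by apply/funext => t; rewrite /Phi /= hornerC sqnorm1.
rewrite big_ord_recr /= -IH.
set S := reversed n (Phi n).
have sP := size_szego_Phi_le alpha n.
have -> : sqnorm2 (Phi n) * (1 - sqnorm (alpha n)) =
    sqnorm2 (Phi n) - sqnorm (alpha n) * sqnorm2 (Phi n) by ring.
have hP := bounded_measurable_horner.
pose q := (cconj (alpha n))%:P * S.
have orthq : cintegral nu (fun t => (Phi n.+1).[expi t] * cconj q.[expi t]) = 0.
  apply: szego_orthogonal; rewrite (leq_trans (size_polyMleq _ _)) //.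
  have := size_reversed n (Phi n); have := size_polyC_leq1 (cconj (alpha n)).
  by rewrite -/S; move: (size _) (size _) => u v; lia.
have hc : cbounded_measurable (fun t => (Phi n.+1).[expi t] * cconj q.[expi t]).
  by apply: cbounded_measurableM; [|apply: cbounded_measurable_conj];
    exact: cbounded_measurable_horner.
have E : (fun t => sqnorm (Phi n).[expi t]) = (fun t => sqnorm (Phi n.+1).[expi t]
   + 2 * complex.Re ((Phi n.+1).[expi t] * cconj q.[expi t])
   + sqnorm (alpha n) * sqnorm (Phi n).[expi t]).
  apply/funext => t.
  have -> : sqnorm (alpha n) * sqnorm (Phi n).[expi t] = sqnorm q.[expi t].
    by rewrite /q hornerM hornerC sqnormM sqnorm_conj sqnorm_reversed_expi.
  have -> : sqnorm (Phi n).[expi t] = sqnorm ((Phi n.+1).[expi t] + q.[expi t]).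
    have -> : (Phi n.+1).[expi t] + q.[expi t] = expi t * (Phi n).[expi t].
      by rewrite /Phi /q /S /= !hornerE subrK.
    by rewrite sqnormM sqnorm_expi mul1r.
  by case: (_.[_]) (q.[_]) => [? ?] [? ?]; rewrite /sqnorm /=; ring.
suff K : sqnorm2 (Phi n) = sqnorm2 (Phi n.+1) + sqnorm (alpha n) * sqnorm2 (Phi n).
  by rewrite {1}K addrK.
have bc := bounded_measurable_cst.
have h1 : bounded_measurable (fun t => sqnorm (alpha n) * sqnorm (Phi n).[expi t]).
  exact: bounded_measurableM.
have [h0 _] := hc.
have h2 : bounded_measurable (fun t => 2 * complex.Re ((Phi n.+1).[expi t] * cconj q.[expi t])).
  exact: bounded_measurableM (bc 2) h0.
have h3 := bounded_measurableD (hP (Phi n.+1)) h2.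
rewrite {1}/sqnorm2 E (int_add h3 h1) (int_add (hP _) h2).
rewrite (int_scale _ (hP _)) (int_scale _ h0).
have -> : int (fun t => complex.Re ((Phi n.+1).[expi t] * cconj q.[expi t])) = 0.
  by move: orthq => /(congr1 (@complex.Re _)).
by rewrite mulr0 addr0.
Qed.

(** The term 2 r Re(F conj S) is kept because it will integrate to 0. The other cross term involves
    z S, whose degree is too high for orthogonality; it is at most |F|^2/4 + 4 |S|^2, and |z - r|^2
    >= 4 for r >= 3 absorbs the part in S. *)
Lemma sqnorm_offset_lower (r : R) (F S z : R[i]) : 3 <= r -> sqnorm z = 1 ->
  3 / 4 * sqnorm F + 2 * r * complex.Re (F * cconj S) <=
  sqnorm (F - (z - r%:C%C) * S).
Proof.
move=> r3 z1.
have h1 : 0 <= sqnorm (F - 4%:C%C * (z * S)) by exact: sqnorm_ge0.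
have rz : complex.Re z <= 1.
  have : complex.Re z ^+ 2 <= 1 by rewrite -z1 lerDl sqr_ge0.
  by move=> h; nra.
have -> : sqnorm (F - (z - r%:C%C) * S) = sqnorm F - 2 * complex.Re (F * cconj (z * S))
   + 2 * r * complex.Re (F * cconj S) + (sqnorm z + r ^+ 2 - 2 * r * complex.Re z) * sqnorm S.
  rewrite /sqnorm; move: F S z {z1 rz h1} => [? ?] [? ?] [? ?] /=; ring.
have E : sqnorm (F - 4%:C%C * (z * S)) = sqnorm F - 8 * complex.Re (F * cconj (z * S))
   + 16 * (sqnorm z * sqnorm S).
  rewrite /sqnorm; move: F S z {z1 rz h1} => [? ?] [? ?] [? ?] /=; ring.
move: h1; rewrite {}E z1 mul1r => h1.
have : 4 <= 1 + r ^+ 2 - 2 * r * complex.Re z by nra.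
have := sqnorm_ge0 S; nra.
Qed.

(* With F = p(r) Phi_N and S = (p(r) Phi_N - Phi_N(r) p) / (X - r), the
   polynomial Phi_N(r) p is F - (z - r) S, and F is orthogonal to S. *)
Lemma szego_Phi_lower N p (r : R) : 3 <= r -> (size p <= N.+1)%N ->
  3 / 4 * sqnorm p.[r%:C%C] * sqnorm2 (Phi N) <=
  sqnorm (Phi N).[r%:C%C] * sqnorm2 p.
Proof.
move=> r3 sp; set c := r%:C%C; set P := Phi N.
have /factor_theorem[S hS] : root (p.[c] *: P - P.[c] *: p) c.
  by rewrite rootE !hornerE mulrC subrr.
have sS : (size S <= N)%N.
  have [->|S0] := eqVneq S 0; first by rewrite size_poly0.
  have : (size (S * ('X - c%:P))%R <= N.+1)%N.
    rewrite -hS (leq_trans (size_polyD _ _)) // geq_max size_polyN.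
    by rewrite !(leq_trans (size_scale_leq _ _)) // size_szego_Phi_le.
  by rewrite size_Mmonic ?monicXsubC // size_XsubC addn2.
pose Q := (cconj p.[c])%:P * S.
have orthQ : cintegral nu (fun t => P.[expi t] * cconj Q.[expi t]) = 0.
  apply: szego_orthogonal; rewrite (leq_trans (size_polyMleq _ _)) //.
  have := size_polyC_leq1 (cconj p.[c]).
  by move: (size _) (size _) sS => u v; lia.
have hc : cbounded_measurable (fun t => P.[expi t] * cconj Q.[expi t]).
  by apply: cbounded_measurableM; [|apply: cbounded_measurable_conj];
    exact: cbounded_measurable_horner.
have pw t : 3 / 4 * sqnorm p.[c] * sqnorm P.[expi t] +
    2 * r * complex.Re (P.[expi t] * cconj Q.[expi t]) <=
    sqnorm P.[c] * sqnorm p.[expi t].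
  have := sqnorm_offset_lower (p.[c] * P.[expi t]) S.[expi t] r3 (sqnorm_expi t).
  have -> : p.[c] * P.[expi t] - (expi t - r%:C%C) * S.[expi t] = P.[c] * p.[expi t].
    have : (p.[c] *: P - P.[c] *: p).[expi t] = (S * ('X - c%:P)).[expi t] by rewrite hS.
    rewrite !hornerE -/c => h; rewrite [(expi t - _) * _]mulrC -h; ring.
  rewrite !sqnormM mulrA.
  by rewrite /Q hornerM hornerC cconjM cconjK mulrCA !mulrA.
have bc := bounded_measurable_cst.
have bh := bounded_measurable_horner.
have h2 : bounded_measurable (fun t => complex.Re (P.[expi t] * cconj Q.[expi t])) by case: hc.
have := int_le _ _ pw; rewrite int_add ?int_scale //.
- have -> : int (fun t => complex.Re (P.[expi t] * cconj Q.[expi t])) = 0.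
    by move: orthQ => /(congr1 (@complex.Re _)).
  rewrite mulr0 addr0; apply; last exact: bounded_measurableM.
  by apply: bounded_measurableD; exact: bounded_measurableM.
- exact: bounded_measurableM.
- exact: bounded_measurableM.
Qed.

End Orthogonality.
End CircleIntegrals.

(** * Rescaled Chebyshev polynomials of an arc *)

Section ArcPolynomials.
Variable R : realType.
Implicit Types (s c t r : R) (n : nat).

(* For s = sqrt(1 - a^2) these are, up to lower order corrections, the
   orthogonal polynomials with constant Verblunsky coefficients a: in the
   half-angle variable they are the rescaled Chebyshev polynomials
   s^n U_n(cos(t/2) / s). *)
Fixpoint arcpoly s n : {poly R[i]} :=
  match n with
  | 0%N => 1
  | k.+1 => match k with
            | 0%N => 'X + 1
            | m.+1 => ('X + 1) * arcpoly s k - ((s ^+ 2)%:C%C)%:P * 'X * arcpoly s m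
            end
  end.

(** The real factor of [arcpoly] at e^(it), with c = cos(t/2), once the phase e^(int/2) is removed;
    on the circle X + 1 is 2 cos(t/2) e^(it/2). *)
Fixpoint arcU s c n : R :=
  match n with
  | 0%N => 1
  | k.+1 => match k with
            | 0%N => 2 * c
            | m.+1 => 2 * c * arcU s c k - s ^+ 2 * arcU s c m
            end
  end.

Lemma arcpolySS s n : arcpoly s n.+2 =
  ('X + 1) * arcpoly s n.+1 - ((s ^+ 2)%:C%C)%:P * 'X * arcpoly s n.
Proof. by []. Qed.

Lemma arcUSS s c n : arcU s c n.+2 = 2 * c * arcU s c n.+1 - s ^+ 2 * arcU s c n.
Proof. by []. Qed.

Lemma nat_ind2 (P : nat -> Prop) : P 0%N -> P 1%N ->
  (forall n, P n -> P n.+1 -> P n.+2) -> forall n, P n.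
Proof.
move=> P0 P1 H n; suff [] : P n /\ P n.+1 by [].
by elim: n => [|n [h1 h2]]; split => //; exact: H.
Qed.

Lemma expi_half t : expi t + 1 = expi (t / 2) * (2 * cos (t / 2))%:C%C.
Proof.
have -> : t = t / 2 + t / 2 by lra.
rewrite expiD (_ : (t / 2 + t / 2) / 2 = t / 2) /expi; last by lra.
have := cos2Dsin2 (t / 2); move: (cos _) (sin _) => x y h.
apply/eqP; rewrite eq_complex /=; apply/andP; split; apply/eqP; first by lra.
by ring.
Qed.

Lemma horner_arcpoly_expi s n t :
  (arcpoly s n).[expi t] = expi (t / 2) ^+ n * (arcU s (cos (t / 2)) n)%:C%C.
Proof.
elim/nat_ind2: n => [||n h0 h1]; first by rewrite /= hornerC expr0 mul1r.
  by rewrite /= !hornerE expi_half expr1.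
rewrite arcpolySS arcUSS hornerD hornerN !hornerM h0 h1 hornerD hornerX !hornerC expi_half.
have -> : expi t = expi (t / 2) * expi (t / 2) by rewrite -expiD -splitr.
rewrite rmorphB !rmorphM /= !exprS; move: (expi (t / 2)) (expi _ ^+ n) => w w'.
by ring.
Qed.

(** A quadratic form that each step of the recursion multiplies by its determinant s^2; for s = 1 it
    is the Chebyshev identity U_(n+1)^2 - 2 c U_(n+1) U_n + U_n^2 = 1. *)
Lemma arcU_invariant s c n :
  arcU s c n.+1 ^+ 2 - 2 * c * arcU s c n.+1 * arcU s c n + s ^+ 2 * arcU s c n ^+ 2
  = (s ^+ 2) ^+ n.+1.
Proof.
elim: n => [|n IH]; first by rewrite /=; ring.
by rewrite arcUSS [RHS]exprS -IH; ring.
Qed.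

Lemma arcU_bound s c n : 0 < s -> `|c| <= s -> `|arcU s c n| <= n.+1%:R * s ^+ n.
Proof.
move=> s0 cs; elim: n => [|n IH]; first by rewrite /= normr1 mul1r expr0.
(* Completing the square, the invariant reads (U_(n+1) - c U_n)^2 + (s^2 - c^2) U_n^2 = s^(2n+2),
   with both terms nonnegative for |c| <= s. *)
have h : `|arcU s c n.+1 - c * arcU s c n| <= s ^+ n.+1.
  rewrite -(@ler_pXn2r _ 2) ?nnegrE ?exprn_ge0 ?(ltW s0)// real_normK ?num_real//.
  rewrite exprAC -(arcU_invariant s c n) -subr_ge0.
  have -> : arcU s c n.+1 ^+ 2 - 2 * c * arcU s c n.+1 * arcU s c n +
      s ^+ 2 * arcU s c n ^+ 2 - (arcU s c n.+1 - c * arcU s c n) ^+ 2 =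
    (s ^+ 2 - c ^+ 2) * arcU s c n ^+ 2 by ring.
  rewrite mulr_ge0 ?sqr_ge0// subr_ge0 -real_normK ?num_real//.
  by rewrite ler_pXn2r ?nnegrE ?(ltW s0).
rewrite -[X in `|X|](subrK (c * arcU s c n)) (le_trans (ler_normD _ _)) //.
have -> : n.+2%:R * s ^+ n.+1 = s ^+ n.+1 + s * (n.+1%:R * s ^+ n).
  by rewrite -[n.+2%:R]natr1 exprS; ring.
by rewrite lerD // normrM ler_pM.
Qed.

Lemma sqnorm_arcpoly_expi s n t :
  sqnorm (arcpoly s n).[expi t] = arcU s (cos (t / 2)) n ^+ 2.
Proof.
rewrite horner_arcpoly_expi sqnormM sqnormX sqnorm_expi expr1n mul1r.
by rewrite /sqnorm /= expr0n addr0.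
Qed.

Lemma size_arcpoly s n : (size (arcpoly s n) <= n.+1)%N.
Proof.
elim/nat_ind2: n => [||n h0 h1].
- by rewrite /= size_poly1.
- by rewrite /= size_XaddC.
rewrite arcpolySS (leq_trans (size_polyD _ _)) // geq_max size_polyN; apply/andP; split.
  by rewrite (leq_trans (size_polyMleq _ _)) // size_XaddC.
rewrite (leq_trans (size_polyMleq _ _)) //.
have : (size (((s ^+ 2)%:C%C)%:P * 'X : {poly R[i]})%R <= 2)%N.
  rewrite mul_polyC (leq_trans (size_scale_leq _ _)) // size_polyX //.
by move: (size _) (size _) h0 => u v; lia.
Qed.

Lemma coef_arcpoly s n : (arcpoly s n)`_n = 1.
Proof.
elim/nat_ind2: n => [||n h0 h1].
- by rewrite /= coef1.
- by rewrite /= coefD coefX coef1 addr0.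
rewrite arcpolySS coefB mulrDl mul1r coefD coefXM /= h1.
rewrite -mulrA coefCM coefXM /= [X in _ + X - _]nth_default.
  by rewrite nth_default ?mulr0 ?subr0 ?addr0 // size_arcpoly.
exact: size_arcpoly.
Qed.

Lemma size_arcpolyE s n : size (arcpoly s n) = n.+1.
Proof.
apply/eqP; rewrite eqn_leq size_arcpoly ltnNge; apply/negP => h.
by have := coef_arcpoly s n; rewrite nth_default // => /eqP; rewrite eq_sym oner_eq0.
Qed.

Lemma lead_coef_arcpoly s n : lead_coef (arcpoly s n) = 1.
Proof. by rewrite lead_coefE size_arcpolyE coef_arcpoly. Qed.

(** The ratio of consecutive values satisfies q' = r + 1 - s^2 r / q, so q >= r + b implies q' >= r
    + 1 - s^2 = r + b. This b becomes a^2 in the final estimate. *)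
Lemma arcpoly_real_lower s r n : 0 < s < 1 -> 0 < r ->
  (r + (1 - s ^+ 2)) ^+ (2 * n) <= sqnorm (arcpoly s n).[r%:C%C].
Proof.
move=> /andP[s0 s1] r0; set b := 1 - s ^+ 2.
have b01 : 0 < b < 1.
  rewrite /b; apply/andP; split; last by rewrite ltrBlDr ltrDl exprn_gt0.
  by rewrite subr_gt0 expr_lt1 // ltW.
have ss : s ^+ 2 = 1 - b by rewrite /b; ring.
have rb : 0 < r + b by lra.
suff [v [-> hv _]] : exists v, [/\ (arcpoly s n).[r%:C%C] = v%:C%C, (r + b) ^+ n <= v &
    exists2 w, (arcpoly s n.+1).[r%:C%C] = w%:C%C & (r + b) * v <= w].
  rewrite /sqnorm /= expr0n addr0 mulnC exprM ler_pXn2r ?nnegrE //.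
  - by rewrite exprn_ge0 // ltW.
  - by rewrite (le_trans _ hv) // exprn_ge0 // ltW.
elim: n => [|n [v [hv vn [w hw vw]]]].
  exists 1; split; rewrite /= ?hornerC ?expr0 //.
  exists (r + 1); last by lra.
  by rewrite !hornerE rmorphD.
have v0 : 0 < v by rewrite (lt_le_trans _ vn) // exprn_gt0.
exists w; split => //.
  by rewrite exprS (le_trans _ vw) // ler_pM2l.
exists ((r + 1) * w - s ^+ 2 * r * v).
  rewrite arcpolySS hornerD hornerN !hornerM hv hw hornerD hornerX !hornerC.
  by rewrite rmorphB !rmorphM rmorphD.
have bv : 0 < b * v by rewrite mulr_gt0 //; lra.
have : 0 <= (1 - b) * (w - r * v) by rewrite mulr_ge0 //; lra.
by rewrite ss; lra.
Qed.

(** The Chebyshev relation expressing (1 - x^2) U_n' through U_n and U_(n-1), in the variable of the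
    circle. The quadratic factor vanishes at the ends of the arc, and at a zero of [arcpoly s n.+1]
    the derivative becomes a multiple of [arcpoly s n]. *)
Lemma deriv_arcpoly s n (S := ((s ^+ 2)%:C%C)%:P : {poly R[i]}) :
  (('X + 1) ^+ 2 - 4%:R * S * 'X) * (arcpoly s n.+1)^`() =
  n.+1%:R * ('X + 1 - 2%:R * S) * arcpoly s n.+1 -
  n.+2%:R * S * ('X - 1) * arcpoly s n.
Proof.
have dS m : (arcpoly s m.+2)^`() = arcpoly s m.+1 + ('X + 1) * (arcpoly s m.+1)^`()
   - S * arcpoly s m - S * 'X * (arcpoly s m)^`().
  by rewrite arcpolySS derivB !derivM derivD derivX !derivC /S; ring.
elim/nat_ind2: n => [||n].
- by rewrite /= derivD derivX derivC /S; ring.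
- by rewrite dS !arcpolySS -/S /= derivD derivX derivC; ring.
move: (dS n.+1) (arcpolySS s n.+1) (arcpolySS s n); rewrite -/S.
move: (arcpoly s n.+3) (arcpoly s n.+2) (arcpoly s n.+1) (arcpoly s n) => p3 p2 p1 p0.
move=> d3 e3 e2 h0 h1; set D := _ - _ in h0 h1 *.
have -> : D * p3^`() =
    D * (p2 - S * p1) + ('X + 1) * (D * p2^`()) - S * 'X * (D * p1^`()).
  by rewrite d3; ring.
rewrite h0 h1 e3 e2 /D.
by rewrite -[n.+4%:R]natr1 -[n.+3%:R]natr1 -[n.+2%:R]natr1; ring.
Qed.

End ArcPolynomials.

(** * Half-angle description of Gamma_a *)

Section ArcGeometry.
Variables (R : realType) (a : R).
Hypothesis a01 : 0 < a < 1.
Implicit Types (c t : R) (z : R[i]).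

(** Equal to cos(asin a), the largest |cos(t/2)| on the arc; it turns out to be the capacity. *)
Definition arc_radius : R := Num.sqrt (1 - a ^+ 2).
Let s := arc_radius.

Lemma sqr_arc_radius : s ^+ 2 = 1 - a ^+ 2.
Proof.
have /andP[a0 a1] := a01; rewrite sqr_sqrtr // subr_ge0 expr_le1 // ltW //.
Qed.

Lemma arc_radius_gt0 : 0 < s.
Proof.
have /andP[a0 a1] := a01; rewrite sqrtr_gt0 subr_gt0 expr_lt1 // ltW //.
Qed.

Lemma arc_radius_lt1 : s < 1.
Proof.
have /andP[a0 a1] := a01.
rewrite -(@ltr_pXn2r _ 2) ?nnegrE ?(ltW arc_radius_gt0)// sqr_arc_radius expr1n.
by rewrite ltrBlDr ltrDl exprn_gt0.
Qed.

Lemma asin_arc : 0 <= asin a <= pi / 2.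
Proof.
have /andP[a0 a1] := a01; have a11 : -1 <= a <= 1 by lra.
rewrite asin_lepi2 // andbT leNgt; apply/negP => h.
have : sin (asin a) < sin 0.
  have := pi_gt0 R; have := asin_geNpi2 a11 => h1 h2.
  by rewrite ltr_sin // in_itv /= ?h1; lra.
by rewrite sin0 asinK ?in_itv //=; lra.
Qed.

Lemma le_acos_asin c t : 0 <= t <= pi -> (asin a <= t) = (cos t <= s).
Proof.
move=> ht; have /andP[a0 a1] := a01; have /andP[as0 as1] := asin_arc.
have <- : cos (asin a) = s by rewrite cos_asin //; lra.
rewrite leNgt -ltr_cos ?in_itv //=; first by rewrite -leNgt.
by have := pi_gt0 R; lra.
Qed.

Lemma Gamma_half_angle z : Gamma a z -> exists2 t, z = expi t & `|cos (t / 2)| <= s.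
Proof.
move=> [t [-> /andP[h1 h2]]]; exists t => //.
have -> : cos (t / 2) = cos (`|t| / 2).
  by have [_|_] := ler0P t; rewrite ?mulNr ?cosN.
have t0 := normr_ge0 t.
rewrite ger0_norm; first by rewrite -le_acos_asin //; lra.
by apply: cos_ge0_pihalf; have := pi_gt0 R; lra.
Qed.

Lemma Gamma_acos c : `|c| <= s -> Gamma a (expi (2 * acos c)).
Proof.
have s1 := arc_radius_lt1; rewrite ler_norml => /andP[h1 h2].
have c1 : -1 <= c <= 1 by lra.
have g0 := acos_ge0 c1; have g1 := acos_lepi c1; have p0 := pi_gt0 R.
have cc : cos (acos c) = c by rewrite acosK.
have [c0|c0] := leP 0 c.
  exists (2 * acos c); split => //; rewrite ger0_norm; last by lra.
  have : asin a <= acos c by rewrite le_acos_asin ?cc //; lra.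
  have : acos c <= pi / 2; last by lra.
  by rewrite leNgt -ltr_cos ?cos_pihalf ?cc ?in_itv //=; lra.
(* For c < 0 the angle 2 acos c exceeds pi, while [Gamma] asks for |t| <= pi. *)
exists (2 * acos c - pi *+ 2); split; first by rewrite expiB2pi.
rewrite ler0_norm; last by lra.
have cN : cos (pi - acos c) = - c by rewrite -acosN // acosK // in_itv /=; lra.
have : asin a <= pi - acos c by rewrite le_acos_asin ?cN //; lra.
have : pi - acos c <= pi / 2; last by lra.
by rewrite leNgt -ltr_cos ?cos_pihalf ?cN ?in_itv //=; lra.
Qed.

Lemma expi_2acos c : -1 <= c <= 1 ->
  expi (2 * acos c) = Complex (2 * c ^+ 2 - 1) (2 * (c * Num.sqrt (1 - c ^+ 2))).
Proof.
move=> c1; have -> : 2 * acos c = acos c + acos c by lra.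
have h := sin_acos c1.
have cc : cos (acos c) = c by rewrite acosK.
have h2 := cos2Dsin2 (acos c); rewrite cc in h2.
rewrite /expi cosD sinD cc -h; apply/eqP; rewrite eq_complex /=.
by apply/andP; split; apply/eqP; lra.
Qed.

Lemma expi_2acos_inj c c' : `|c| <= s -> `|c'| <= s ->
  expi (2 * acos c) = expi (2 * acos c') -> c = c'.
Proof.
have s1 := arc_radius_lt1; have s0 := arc_radius_gt0.
rewrite !ler_norml => /andP[h1 h2] /andP[h3 h4].
rewrite !expi_2acos; [|lra..] => -[e1 e2].
have e : c ^+ 2 = c' ^+ 2 by lra.
have : 0 < Num.sqrt (1 - c ^+ 2) by rewrite sqrtr_gt0; nra.
rewrite -e in e2 => q0; have q1 : Num.sqrt (1 - c ^+ 2) != 0 by rewrite gt_eqF.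
by apply: (mulIf q1); lra.
Qed.

End ArcGeometry.

(** * Vandermonde products, determinants and discriminants *)

Section VandermondeProducts.
Variable R : realType.
Implicit Types (n : nat).

Definition vdm_abs n (z : 'I_n -> R[i]) : R :=
  \prod_(i < n) \prod_(j < n | (i < j)%N) cnorm (z i - z j).

Lemma cnormN (x : R[i]) : cnorm (- x) = cnorm x.
Proof. by rewrite /cnorm -!/(sqnorm _) sqnormN. Qed.

Lemma cnorm1 : cnorm (1 : R[i]) = 1.
Proof. by rewrite /cnorm -/(sqnorm _) sqnorm1 sqrtr1. Qed.

Lemma cnorm0 : cnorm (0 : R[i]) = 0.
Proof. by rewrite /cnorm -/(sqnorm _) sqnorm0 sqrtr0. Qed.

Lemma cnorm_prod I (r : seq I) (P : pred I) (F : I -> R[i]) :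
  cnorm (\prod_(i <- r | P i) F i) = \prod_(i <- r | P i) cnorm (F i).
Proof. exact: (big_morph _ (@cnormM R) cnorm1). Qed.

Lemma cnorm_sum_le I (r : seq I) (P : pred I) (F : I -> R[i]) :
  cnorm (\sum_(i <- r | P i) F i) <= \sum_(i <- r | P i) cnorm (F i).
Proof.
elim/big_ind2: _ => [|x u y v h1 h2|//]; first by rewrite cnorm0.
by rewrite (le_trans (cnormD_le _ _)) // lerD.
Qed.

Lemma vdm_abs_ge0 n (z : 'I_n -> R[i]) : 0 <= vdm_abs z.
Proof. by do 2 (apply: prodr_ge0 => ? _); exact: cnorm_ge0. Qed.

(** Grouped by points, so that each inner product is |p'(z_i)| for the monic p with these roots. *)
Lemma vdm_abs_sqr n (z : 'I_n -> R[i]) :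
  vdm_abs z ^+ 2 = \prod_(i < n) \prod_(j < n | j != i) cnorm (z i - z j).
Proof.
rewrite expr2 {2}/vdm_abs (exchange_big_dep predT) //= -big_split /=.
apply: eq_bigr => i _; rewrite [RHS](bigID (fun j : 'I_n => (i < j)%N)) /=.
congr (_ * _); first by apply: eq_bigl => j; rewrite -val_eqE /=; case: ltngtP.
apply: eq_big => [j|j _]; first by rewrite -val_eqE /=; case: ltngtP.
by rewrite -cnormN opprB.
Qed.

(** The Leibniz expansion. The loss of n! is harmless, since its root of order n(n-1)/2 tends to
    1. *)
Lemma cnorm_det_le n (A : 'M[R[i]]_n) (B : 'I_n -> R) :
  (forall i j, cnorm (A i j) <= B i) -> cnorm (\det A) <= n`!%:R * \prod_i B i.
Proof.
move=> AB; rewrite /determinant (le_trans (cnorm_sum_le _ _ _)) //.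
have -> : n`!%:R * \prod_i B i = \sum_(u : 'S_n) \prod_i B i.
  by rewrite sumr_const mulr_natl card_Sn.
apply: ler_sum => u _; rewrite cnormM.
have -> : cnorm ((-1) ^+ u : R[i]) = 1.
  by case: (odd_perm u); rewrite ?expr0 ?expr1 ?cnormN cnorm1.
rewrite mul1r cnorm_prod; apply: ler_prod => i _.
by rewrite cnorm_ge0 AB.
Qed.

(* Row operations turn the Vandermonde matrix into the matrix of the values
   of any sequence of monic polynomials of degrees 0, 1, 2, ... *)
Lemma det_monic_Vandermonde n (p : nat -> {poly R[i]}) (z : 'I_n -> R[i]) :
  (forall i, (size (p i) <= i.+1)%N) -> (forall i, (p i)`_i = 1) ->
  cnorm (\det (\matrix_(i < n, j < n) (p i).[z j])) = vdm_abs z.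
Proof.
move=> sp cp.
have -> : \matrix_(i < n, j < n) (p i).[z j] =
    (\matrix_(i < n, k < n) (p i)`_k) *m Vandermonde n (\row_j z j).
  apply/matrixP => i j; rewrite !mxE (@horner_coef_wide _ n); last first.
    by rewrite (leq_trans (sp i)).
  by apply: eq_bigr => k _; rewrite !mxE.
rewrite det_mulmx det_trig; last first.
  apply/is_trig_mxP => i j ij; rewrite mxE nth_default //.
  by rewrite (leq_trans (sp i)).
rewrite big1; last by move=> i _; rewrite mxE cp.
rewrite mul1r det_Vandermonde cnorm_prod; apply: eq_bigr => i _.
rewrite cnorm_prod; apply: eq_bigr => j _.
by rewrite !mxE -cnormN opprB.
Qed.

Lemma deriv_prod_XsubC n (z : 'I_n -> R[i]) k :
  (\prod_(j < n) ('X - (z j)%:P))^`().[z k] = \prod_(j < n | j != k) (z k - z j).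
Proof.
rewrite (bigD1 k) //= derivM derivXsubC mul1r hornerD hornerM hornerXsubC.
rewrite subrr mul0r addr0 horner_prod; apply: eq_bigr => j _.
by rewrite hornerXsubC.
Qed.

End VandermondeProducts.

(** * Capacity of the arc as its transfinite diameter *)

Section Capacity.
Variables (R : realType) (a : R).
Hypothesis a01 : 0 < a < 1.
Let s := arc_radius a.
Let s_gt0 : 0 < s := arc_radius_gt0 a01.

Lemma near_div_le (c e : R) : 0 < e -> \forall m \near \oo, c / m.+1%:R <= e.
Proof.
move=> e0; have c1 : 0 < `|c| + 1 by have := normr_ge0 c; lra.
have := near_infty_natSinv_lt (PosNum (divr_gt0 e0 c1)); apply: filterS => m /=.
rewrite ltr_pdivlMr // => /ltW; apply: le_trans.
rewrite mulrC ler_pM2l ?invr_gt0 ?ltr0Sn//.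
by rewrite (le_trans (ler_norm c)) // lerDl.
Qed.

(** Applied with small d, it makes logarithms of N negligible against N. *)
Lemma ln_le_lin (d x : R) : 0 < d -> 0 < x -> ln x <= d * x - ln d.
Proof.
move=> d0 x0; have := ln_sublinear (mulr_gt0 d0 x0).
by rewrite lnM ?posrE //; lra.
Qed.

(** Row i of the determinant of the arc polynomials is at most (i+1) s^i on the arc. One n! comes
    from the Leibniz expansion, the other from the factors i+1. *)
Lemma vdm_abs_Gamma_le n (z : 'I_n -> R[i]) : (forall i, Gamma a (z i)) ->
  vdm_abs z <= n`!%:R ^+ 2 * s ^+ (\sum_(i < n) i).
Proof.
move=> hz; rewrite -(@det_monic_Vandermonde _ _ (arcpoly s)) //; last 2 first.
- exact: size_arcpoly.
- exact: coef_arcpoly.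
apply: le_trans (cnorm_det_le (B := fun i => i.+1%:R * s ^+ i) _) _ => [i j|].
  rewrite mxE; have [t -> ht] := Gamma_half_angle a01 (hz j).
  rewrite -(@ler_pXn2r _ 2) ?nnegrE ?cnorm_ge0 ?mulr_ge0 ?exprn_ge0 ?(ltW s_gt0)//.
  rewrite sqr_cnorm sqnorm_arcpoly_expi -(real_normK (num_real (arcU _ _ _))).
  rewrite ler_pXn2r ?nnegrE ?normr_ge0 ?mulr_ge0 ?exprn_ge0 ?(ltW s_gt0)//.
  exact: arcU_bound.
rewrite big_split /= -natr_prod.
have -> : (\prod_(i < n) i.+1 = n`!)%N.
  elim: n {z hz} => [|n IH]; first by rewrite big_ord0.
  by rewrite big_ord_recr /= IH mulnC.
by rewrite prodrXr mulrA -expr2.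
Qed.

(** The zeros of U_(m+1) are the cosines of these angles; k.+1 skips the angle 0. The points [zpt]
    are then the zeros of [arcpoly s m.+1], and serve as test points because their discriminant can
    be estimated from below. *)
Let theta m (k : 'I_m.+1) : R := k.+1%:R * pi / m.+2%:R.
Let node m (k : 'I_m.+1) : R := s * cos (theta k).
Let zpt m (k : 'I_m.+1) : R[i] := expi (2 * acos (node k)).

Lemma theta_itv m (k : 'I_m.+1) : 0 < theta k < pi.
Proof.
have p0 := pi_gt0 R; rewrite /theta divr_gt0 ?mulr_gt0 ?ltr0Sn //=.
by rewrite ltr_pdivrMr ?ltr0Sn// mulrC ltr_pM2l // ltr_nat ltnS.
Qed.

Lemma node_bound m (k : 'I_m.+1) : `|node k| <= s.
Proof. by rewrite normrM gtr0_norm // ler_piMr ?(ltW s_gt0) // cos_max. Qed.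

Lemma sin_natpi k : sin (k%:R * pi : R) = 0.
Proof.
elim: k => [|k IH]; first by rewrite mul0r sin0.
by rewrite -natr1 mulrDl mul1r sinDpi IH oppr0.
Qed.

Lemma arcU_cos n (t : R) : arcU s (s * cos t) n * sin t = s ^+ n * sin (n.+1%:R * t).
Proof.
elim/nat_ind2: n => [||n h0 h1].
- by rewrite /= expr0 !mul1r.
- have -> : 2%:R * t = t + t by lra.
  by rewrite /= expr1 sinD; ring.
rewrite arcUSS.
have -> : (2 * (s * cos t) * arcU s (s * cos t) n.+1 - s ^+ 2 * arcU s (s * cos t) n) * sin t =
    2 * s * cos t * (arcU s (s * cos t) n.+1 * sin t)
      - s ^+ 2 * (arcU s (s * cos t) n * sin t) by ring.
rewrite h0 h1.
have -> : sin (n.+3%:R * t) = 2 * cos t * sin (n.+2%:R * t) - sin (n.+1%:R * t).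
  have -> : n.+3%:R * t = n.+2%:R * t + t by rewrite -[n.+3%:R]natr1; ring.
  have -> : n.+1%:R * t = n.+2%:R * t - t by rewrite -[n.+2%:R]natr1; ring.
  by rewrite sinB sinD; ring.
by rewrite !exprS; ring.
Qed.

Lemma arcU_node m (k : 'I_m.+1) : arcU s (node k) m.+1 = 0.
Proof.
have st : sin (theta k) != 0 by rewrite gt_eqF // sin_gt0_pi // theta_itv.
apply: (mulIf st); rewrite mul0r arcU_cos /theta mulrCA mulfV ?mulr1 ?pnatr_eq0//.
by rewrite sin_natpi mulr0.
Qed.

Lemma zpt_Gamma m (k : 'I_m.+1) : Gamma a (zpt k).
Proof. by apply: Gamma_acos => //; exact: node_bound. Qed.

Lemma zpt_inj m : injective (@zpt m).
Proof.
move=> k l /(expi_2acos_inj a01 (node_bound k) (node_bound l)).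
move=> /(mulfI (lt0r_neq0 s_gt0)) => h.
have hin (i : 'I_m.+1) : theta i \in `[0, pi].
  by have /andP[t0 tp] := theta_itv i; rewrite in_itv /= !ltW.
have m0 : (m.+2%:R : R)^-1 != 0 by rewrite invr_eq0 pnatr_eq0.
have /(mulIf m0) /(mulIf (lt0r_neq0 (pi_gt0 R))) /eqP : theta k = theta l.
  exact: cos_inj.
by rewrite eqr_nat eqSS => /eqP /val_inj.
Qed.

Lemma half_acos c : 2 * acos c / 2 = acos c :> R.
Proof. by lra. Qed.

Lemma cos_half_zpt m (k : 'I_m.+1) : cos (2 * acos (node k) / 2) = node k.
Proof.
rewrite half_acos acosK // in_itv /=.
have := node_bound k; rewrite ler_norml => /andP[].
by have := arc_radius_lt1 a01; rewrite -/s; lra.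
Qed.

Lemma arcpoly_factor m : arcpoly s m.+1 = \prod_(k < m.+1) ('X - (zpt k)%:P).
Proof.
rewrite [LHS](@all_roots_prod_XsubC _ _ [seq zpt k | k <- enum 'I_m.+1]).
- by rewrite lead_coef_arcpoly scale1r big_map big_enum /=; apply: eq_bigl => k; rewrite inE.
- by rewrite size_arcpolyE size_map size_enum_ord.
- apply/allP => _ /mapP[k _ ->]; rewrite rootE -sqnorm_eq0 sqnorm_arcpoly_expi.
  by rewrite cos_half_zpt arcU_node expr0n.
- by rewrite uniq_rootsE map_inj_uniq ?enum_uniq //; exact: zpt_inj.
Qed.

(** At a zero, [deriv_arcpoly] keeps only the term in [arcpoly s m], of modulus s^m by
    [arcU_invariant]. On the arc |z - 1| >= 2 a, and the quadratic factor is at most 8; hence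
    a/4. *)
Lemma deriv_arcpoly_zpt m (k : 'I_m.+1) :
  a / 4 * s ^+ m.+2 <= cnorm (arcpoly s m.+1)^`().[zpt k].
Proof.
have /andP[a0 a1] := a01; have ss := sqr_arc_radius a01; rewrite -/s in ss.
have s1 := arc_radius_lt1 a01; rewrite -/s in s1.
have R0 : (arcpoly s m.+1).[zpt k] = 0.
  by apply/eqP; rewrite -sqnorm_eq0 sqnorm_arcpoly_expi cos_half_zpt arcU_node expr0n.
have Rm : sqnorm (arcpoly s m).[zpt k] = (s ^+ m) ^+ 2.
  rewrite sqnorm_arcpoly_expi cos_half_zpt.
  have := arcU_invariant s (node k) m; rewrite arcU_node expr0n /= mulr0 mul0r subr0 add0r.
  have s20 : s ^+ 2 != 0 by rewrite sqrf_eq0 gt_eqF.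
  by rewrite (exprS (s ^+ 2) m) => /(mulfI s20) ->; rewrite exprAC.
have := congr1 (fun p => cnorm p.[zpt k]) (deriv_arcpoly s m).
rewrite [in X in X = _ -> _]hornerM [in X in X = _ -> _]cnormM.
rewrite [in X in _ = X -> _]hornerD [in X in _ = X -> _]hornerN.
rewrite [in X in _ = X -> _](hornerM _ (arcpoly s m.+1)) R0 mulr0 add0r cnormN.
rewrite 3!hornerM !cnormM.
have -> : cnorm (m.+2%:R : {poly R[i]}).[zpt k] = m.+2%:R.
  by rewrite -polyC_natr hornerC -(rmorph_nat (real_complex R)) /cnorm /= expr0n addr0
    sqrtr_sqr ger0_norm.
have -> : cnorm (arcpoly s m).[zpt k] = s ^+ m.
  by rewrite /cnorm -/(sqnorm _) Rm sqrtr_sqr ger0_norm // exprn_ge0 // ltW.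
have -> : cnorm (((s ^+ 2)%:C%C)%:P : {poly R[i]}).[zpt k] = s ^+ 2.
  by rewrite hornerC /cnorm /= expr0n addr0 sqrtr_sqr ger0_norm // sqr_ge0.
have z1 : 2 * a <= cnorm ('X - 1 : {poly R[i]}).[zpt k].
  rewrite -(@ler_pXn2r _ 2) ?nnegrE ?cnorm_ge0 ?mulr_ge0 ?(ltW a0)// sqr_cnorm.
  rewrite !hornerE /zpt expi_2acos; last first.
    by have := node_bound k; rewrite ler_norml => /andP[]; lra.
  have := node_bound k; rewrite ler_norml => /andP[n1 n2].
  rewrite /sqnorm /=.
  have h : Num.sqrt (1 - node k ^+ 2) ^+ 2 = 1 - node k ^+ 2 by rewrite sqr_sqrtr //; nra.
  have h3 : node k ^+ 2 <= s ^+ 2 by nra.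
  set q := Num.sqrt _ in h *; set c := node k in h h3 *.
  have -> : (2 * c ^+ 2 - 1 - 1) ^+ 2 + (2 * (c * q) - 0) ^+ 2 =
      (2 * c ^+ 2 - 2) ^+ 2 + 4 * c ^+ 2 * q ^+ 2 by ring.
  by rewrite h; lra.
have D8 : cnorm (('X + 1) ^+ 2 - 4%:R * ((s ^+ 2)%:C%C)%:P * 'X : {poly R[i]}).[zpt k] <= 8.
  have c1 : cnorm (zpt k) = 1 by rewrite /cnorm -/(sqnorm _) sqnorm_expi sqrtr1.
  have -> : (('X + 1) ^+ 2 - 4%:R * ((s ^+ 2)%:C%C)%:P * 'X : {poly R[i]}).[zpt k] =
      (zpt k + 1) * (zpt k + 1) - 4 * (s ^+ 2)%:C%C * zpt k.
    by rewrite hornerD hornerN expr2 !hornerM hornerD hornerX !hornerC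
      -[4%:R]polyC_natr hornerC.
  rewrite (le_trans (cnormD_le _ _)) // cnormN !cnormM c1 mulr1.
  have h1 : cnorm (zpt k + 1) <= 2 by rewrite (le_trans (cnormD_le _ _)) // c1 cnorm1; lra.
  have h2 : cnorm (4 * (s ^+ 2)%:C%C) <= 4.
    rewrite -(rmorph_nat (real_complex R)) -rmorphM /cnorm /= expr0n addr0 sqrtr_sqr.
    have s21 : 0 < s ^+ 2 < 1 by rewrite exprn_gt0 //= expr_lt1 // ltW.
    by rewrite ger0_norm; lra.
  have h0 := cnorm_ge0 (zpt k + 1); rewrite cnormM in h2.
  rewrite [leRHS](_ : 8 = 4 + 4); last by ring.
  by rewrite lerD //; nra.
set X := cnorm (arcpoly s m.+1)^`().[zpt k]; move=> E; set Q := cnorm _ in D8 E; set Z := cnorm _ in z1 E.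
have X0 : 0 <= X by exact: cnorm_ge0.
have sm : 0 < s ^+ m by exact: exprn_gt0.
have : Q * X <= 8 * X by rewrite ler_wpM2r.
have -> : s ^+ m.+2 = s ^+ 2 * s ^+ m by rewrite -exprD.
have : s ^+ 2 * (2 * a) * s ^+ m <= m.+2%:R * s ^+ 2 * Z * s ^+ m.
  rewrite ler_pM2r // -mulrA; apply: le_trans (_ : s ^+ 2 * Z <= _).
    by rewrite ler_pM2l // exprn_gt0.
  have sZ : 0 <= s ^+ 2 * Z by apply: mulr_ge0; [exact: sqr_ge0|exact: cnorm_ge0].
  by apply: ler_peMl => //; rewrite ler1n.
rewrite -E; lra.
Qed.

Lemma vdm_abs_zpt m : (a / 4 * s ^+ m.+2) ^+ m.+1 <= vdm_abs (@zpt m) ^+ 2.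
Proof.
have /andP[a0 a1] := a01.
rewrite vdm_abs_sqr -[X in _ ^+ X]card_ord -prodr_const.
apply: ler_prod => k _; rewrite mulr_ge0 ?exprn_ge0 ?(ltW s_gt0) //=; last by lra.
by rewrite -cnorm_prod -deriv_prod_XsubC -arcpoly_factor deriv_arcpoly_zpt.
Qed.

Lemma ln_fact_le n : ln (n`!%:R : R) <= n%:R * ln n%:R.
Proof.
case: n => [|n]; first by rewrite fact0 ln1 mul0r.
rewrite mulr_natl -lnXn ?ltr0Sn// ler_ln ?posrE ?exprn_gt0 ?ltr0n ?fact_gt0//.
rewrite -natrX ler_nat; elim: n.+1 => // k IH.
rewrite factS expnS leq_mul // (leq_trans IH) //.
by case: k {IH} => // k; rewrite leq_exp2r.
Qed.

Lemma natr_sum_ord n : (\sum_(i < n) i)%:R = n%:R * (n%:R - 1) / 2 :> R.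
Proof.
elim: n => [|n IH]; first by rewrite big_ord0 mul0r mul0r.
by rewrite big_ord_recr /= natrD IH -[n.+1%:R]natr1; field.
Qed.

(** With N points, both Vandermonde estimates are s^(N(N-1)/2) up to factors exp(O(N ln N)), which
    disappear after the root of order N(N-1)/2. *)
Lemma diam_Gamma_bounds n (m := n.+1) :
  [/\ 0 < diam_n (Gamma a) n.+2,
      ln s + (2 * ln s + ln (a / 4)) / m%:R <= ln (diam_n (Gamma a) n.+2) &
      ln (diam_n (Gamma a) n.+2) <= ln s + 4 / m%:R * ln n.+2%:R].
Proof.
have /andP[a0 a1] := a01.
set A := [set d | exists z : 'I_n.+2 -> R[i], (forall i, Gamma a (z i)) /\
   d = powR (vdm_abs z) (2 / (n.+2%:R * (n.+2%:R - 1)))].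
have -> : diam_n (Gamma a) n.+2 = sup A by [].
have en : n.+2%:R - 1 = m%:R :> R by rewrite -[n.+2%:R]natr1 addrK.
rewrite en in A *.
set e := 2 / (n.+2%:R * m%:R) in A *.
have m0 : 0 < m%:R :> R by rewrite ltr0n.
have n0 : 0 < n.+2%:R :> R by rewrite ltr0n.
have e0 : 0 < e by rewrite divr_gt0 // mulr_gt0.
pose B : R := n.+2`!%:R ^+ 2 * s ^+ (\sum_(i < n.+2) i).
have f0 : 0 < n.+2`!%:R :> R by rewrite ltr0n fact_gt0.
have B0 : 0 < B by rewrite mulr_gt0 // exprn_gt0.
have ubA : ubound A (powR B e).
  move=> d [z [hz ->]]; apply: ge0_ler_powR; rewrite ?nnegrE ?(ltW e0) ?(ltW B0) //.
    exact: vdm_abs_ge0.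
  exact: vdm_abs_Gamma_le.
pose V := vdm_abs (@zpt n.+1).
have AV : A (powR V e) by exists (@zpt n.+1); split => // i; exact: zpt_Gamma.
have supA : has_sup A by split; [exists (powR V e)|exists (powR B e)].
pose K : R := a / 4 * s ^+ n.+3.
have K0 : 0 < K by rewrite mulr_gt0 ?exprn_gt0 //; lra.
have KV : K ^+ n.+2 <= V ^+ 2 by exact: vdm_abs_zpt.
have V0 : 0 < V.
  rewrite lt_def vdm_abs_ge0 andbT -sqrf_eq0 gt_eqF //.
  by apply: lt_le_trans KV; rewrite exprn_gt0.
have VA : powR V e <= sup A := ub_le_sup supA.2 AV.
have AB : sup A <= powR B e := ge_sup supA.1 ubA.
have pV : 0 < powR V e by rewrite powR_gt0.
have pA : 0 < sup A by exact: lt_le_trans VA.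
split => //.
- apply: le_trans (_ : ln (powR V e) <= _); last by rewrite ler_ln ?posrE.
  rewrite ln_powR.
  have : n.+2%:R * ln K <= 2 * ln V.
    by rewrite !mulr_natl -!lnXn // ler_ln ?posrE ?exprn_gt0.
  have -> : ln K = ln (a / 4) + n.+3%:R * ln s.
    by rewrite /K lnM ?posrE ?exprn_gt0 ?lnXn ?mulr_natl //; lra.
  move=> h.
  have : e * (n.+2%:R * (ln (a / 4) + n.+3%:R * ln s)) <= e * (2 * ln V) by rewrite ler_pM2l.
  have -> : e * (n.+2%:R * (ln (a / 4) + n.+3%:R * ln s)) =
    2 * (ln s + (2 * ln s + ln (a / 4)) / m%:R).
    have -> : n.+3%:R = m%:R + 2 :> R by rewrite -natrD addn2.
    rewrite /e; move: (m%:R) (n.+2%:R) m0 n0 => M N M0 N0.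
    by field; rewrite !gt_eqF.
  by lra.
- apply: le_trans (_ : ln (powR B e) <= _); first by rewrite ler_ln ?posrE ?powR_gt0.
  rewrite ln_powR /B lnM ?posrE ?exprn_gt0 // !lnXn //.
  rewrite -[ln s *+ _]mulr_natl -[ln _ *+ 2]mulr_natl natr_sum_ord en.
  have := ln_fact_le n.+2; rewrite -(ler_pM2l e0) => h.
  have -> : e * (2 * ln n.+2`!%:R + n.+2%:R * m%:R / 2 * ln s) =
     2 * (e * ln n.+2`!%:R) + ln s.
    rewrite /e; move: (ln n.+2`!%:R : R) (m%:R : R) (n.+2%:R : R) m0 n0 => L M N M0 N0.
    by field; rewrite !gt_eqF.
  have -> : 4 / m%:R * ln n.+2%:R = 2 * (e * (n.+2%:R * ln n.+2%:R)).
    rewrite /e; move: (ln n.+2%:R : R) (m%:R : R) (n.+2%:R : R) m0 n0 => L M N M0 N0.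
    by field; rewrite !gt_eqF.
  by lra.
Qed.

Lemma capacity_Gamma : capacity (Gamma a) = arc_radius a.
Proof.
apply/cvg_lim => //; rewrite -/s.
suff h : ln (diam_n (Gamma a) n.+2) @[n --> \oo] --> ln s.
  have := cvg_comp _ _ h (@continuous_expR R (ln s)).
  rewrite lnK ?posrE //; apply: cvg_trans; apply: near_eq_cvg; near=> n => /=.
  by rewrite lnK // posrE; have [] := diam_Gamma_bounds n.
apply/cvgrPdist_le => e e0; near=> n.
have [_ lo hi] := diam_Gamma_bounds n; rewrite distrC ler_norml; apply/andP; split.
  have : - (2 * ln s + ln (a / 4)) / n.+1%:R <= e by near: n; exact: near_div_le.
  by rewrite mulNr; move: (_ / _) lo => x; lra.
have d0 : 0 < e / 16 by lra.
have n1 : 0 < n.+1%:R :> R by rewrite ltr0n.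
have := ln_le_lin d0 (ltr0Sn R n.+1); set L := ln n.+2%:R => hL.
have : 4 / n.+1%:R * L <= 4 / n.+1%:R * (e / 16 * n.+2%:R - ln (e / 16)).
  by rewrite ler_pM2l // divr_gt0.
have -> : 4 / n.+1%:R * (e / 16 * n.+2%:R - ln (e / 16)) =
   e / 4 + (e / 4 - 4 * ln (e / 16)) / n.+1%:R.
  by rewrite -[n.+2%:R]natr1; field; rewrite gt_eqF.
have : (e / 4 - 4 * ln (e / 16)) / n.+1%:R <= e / 4.
  by near: n; apply: near_div_le; lra.
by move: (_ / _) (_ * L) hi => x y; lra.
Unshelve. all: by end_near. Qed.

End Capacity.

(** * The support near the arc, and the trial polynomials *)

Section SupportOnArc.
Variables (R : realType) (nu : probability R R).
Implicit Types (t u e : R) (z : R[i]).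

Lemma near_expi t e : 0 < e -> \forall u \near t, cnorm (expi u - expi t) < e.
Proof.
move=> e0; have e2 : 0 < e / 2 by lra.
have := @continuous_cos R t; move=> /cvgrPdist_lt /(_ _ e2) hc.
have := @continuous_sin R t; move=> /cvgrPdist_lt /(_ _ e2) hs.
near=> u.
have hcu : `|cos t - cos u| < e / 2 by near: u.
have hsu : `|sin t - sin u| < e / 2 by near: u.
rewrite -(@ltr_pXn2r _ 2) ?nnegrE ?cnorm_ge0 ?(ltW e0)// sqr_cnorm /sqnorm /=.
move: hcu hsu; rewrite !ltr_norml => /andP[h1 h2] /andP[h3 h4]; nra.
Unshelve. all: by end_near. Qed.

Lemma measurable_preball z e : measurable (preball z e : set R).
Proof.
have [e0|e0] := leP e 0.
  rewrite (_ : preball z e = set0) //; apply/seteqP; split=> // t /=.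
  by rewrite /preball /= ltNge (le_trans e0) // cnorm_ge0.
have hF : cbounded_measurable (fun t => expi t + - z).
  apply: cbounded_measurableD; first exact: cbounded_measurable_expi.
  exact: cbounded_measurable_cst.
have [mf _] := bounded_measurable_sqnorm hF.
rewrite (_ : preball z e = setT `&` (fun t => sqnorm (expi t - z)) @^-1` `]-oo, e ^+ 2[%classic).
  by apply: mf => //; exact: measurable_itv.
rewrite setTI; apply/seteqP; split=> t /=; rewrite in_itv /= -sqr_cnorm /preball /=.
  by rewrite ltr_pXn2r ?nnegrE ?cnorm_ge0 ?(ltW e0).
by rewrite ltr_pXn2r ?nnegrE ?cnorm_ge0 ?(ltW e0).
Qed.

(** Second countability: an angle off the support lies in a null interval with rational ends, and
    [N] enumerates these countably many intervals. *)
Lemma ae_supp : {ae nu, forall t, supp nu (expi t)}.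
Proof.
pose I (q : rat * rat) : set R := `]ratr q.1, ratr q.2[%classic.
pose N (n : nat) : set R := if unpickle n is Some q then
  (if `[< nu (I q) = 0%E >] then I q else set0) else set0.
have hN : nu.-negligible (\bigcup_n N n).
  apply: negligible_bigcup => n; rewrite /N; case: unpickle => [q|]; last first.
    exact: negligible_set0.
  case: asboolP => [h|_]; last exact: negligible_set0.
  by exists (I q); split => //; exact: measurable_itv.
apply: negligibleS hN => t /= /existsNP[e /not_implyP[e0 ne]].
have /nbhs_ballP[d /= d0 hd] := near_expi t e0.
have /rat_in_itvoo[q1] : t - d < t by lra.
have /rat_in_itvoo[q2] : t < t + d by lra.
rewrite !in_itv /= => /andP[h3 h4] /andP[h1 h2].
have It : I (q1, q2) t by rewrite /I /= in_itv /= h2 h3.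
have [n hn] : exists n, unpickle n = Some (q1, q2).
  by exists (pickle (q1, q2)); rewrite pickleK.
exists n; first exact: Logic.I.
rewrite /N hn; case: asboolP => [_|]; first exact: It.
move=> []; apply/eqP; rewrite -measure_le0.
apply: le_trans (_ : (nu (preball (expi t) e) <= 0)%E); last by rewrite leNgt; apply/negP.
apply: le_measure; rewrite ?inE; [exact: measurable_itv|exact: measurable_preball|].
move=> u; rewrite /I /= in_itv /= => /andP[u1 u2]; apply: hd => /=.
by rewrite /ball /= ltr_norml; lra.
Qed.

Variable a : R.
Hypothesis a01 : 0 < a < 1.
Hypothesis ess : ess_supp nu = Gamma a.

Variable s : R.
Hypothesis s_gt : arc_radius a < s.

(** Since (1 + cos t)/2 = cos(t/2)^2, these are the support points beyond the arc of radius s. The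
    condition |t| <= pi makes the set bounded, so that an infinite one would accumulate. *)
Definition off_arc : set R :=
  [set t | `|t| <= pi /\ supp nu (expi t) /\ s ^+ 2 < (1 + cos t) / 2].

Lemma sqr_cos_half t : cos (t / 2) ^+ 2 = (1 + cos t) / 2.
Proof.
have {2}-> : t = t / 2 + t / 2 by lra.
by rewrite cosD; have := cos2Dsin2 (t / 2); lra.
Qed.

Lemma expi_inj_near t u : `|t - u| < pi -> expi t = expi u -> t = u.
Proof.
move=> tu h; have h1 : expi (t - u) = 1.
  apply: (mulIf (_ : expi u != 0)); first by rewrite -sqnorm_eq0 sqnorm_expi oner_eq0.
  by rewrite -expiD subrK mul1r.
have h2 : cos `|t - u| = cos 0.
  have := congr1 (@complex.Re R) h1; rewrite cos0 /=.
  by have [_|_] := ler0P (t - u); rewrite ?cosN.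
have := pi_ge0 R => p0.
have := cos_inj _ _ h2; rewrite !in_itv /= normr_ge0 (ltW tu) lexx p0.
by move=> /(_ isT isT) /normr0_eq0 /subr0_eq.
Qed.

(* An accumulation point of [off_arc] would lie in the essential support. *)
Lemma finite_off_arc : finite_set off_arc.
Proof.
apply: contrapT => inf.
have bd : bounded_set off_arc.
  exists pi; split; first exact: num_real.
  by move=> x px t [tp _]; rewrite /= (le_trans tp) // ltW.
have [t0 ht0] := infinite_bounded_limit_point_nonempty inf bd.
have near_pt (e : R) : 0 < e -> exists2 t, off_arc t &
    [/\ t != t0, `|t - t0| < pi, `|cos t - cos t0| < e & cnorm (expi t - expi t0) < e].
  move=> e0; have : nbhs t0 [set u | [/\ `|u - t0| < pi, `|cos u - cos t0| < e
      & cnorm (expi u - expi t0) < e]].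
    have := @continuous_cos R t0; move=> /cvgrPdist_lt /(_ _ e0) hc.
    have he := near_expi t0 e0.
    have hb : \forall u \near t0, `|u - t0| < pi.
      apply/nbhs_ballP; exists pi => /=; first exact: pi_gt0.
      by move=> u; rewrite /ball /= distrC.
    near=> u; split; [by near: u| |by near: u].
    by rewrite distrC; near: u.
  by move=> /ht0[t [tt0 St [h1 h2 h3]]]; exists t.
have p0 := pi_gt0 R.
have supp0 : supp nu (expi t0).
  move=> e e0; have e2 : 0 < e / 2 by lra.
  have [t [_ [st _]] [_ _ _ ht]] := near_pt _ e2.
  apply: lt_le_trans (st _ e2) _.
  apply: le_measure; rewrite ?inE; [exact: measurable_preball|exact: measurable_preball|].
  move=> u; rewrite /preball /= => hu.
  have -> : expi u - expi t0 = (expi u - expi t) + (expi t - expi t0) by ring.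
  by apply: le_lt_trans (cnormD_le _ _) _; lra.
have : ess_supp nu (expi t0).
  split => // -[e e0 he].
  have [t [_ [st _]] [tt0 tp _ ht]] := near_pt _ e0.
  by move/eqP: tt0; apply; apply: expi_inj_near => //; exact: he.
(* With rho the arc radius, membership in the arc gives cos t0 <= 2 rho^2 - 1, whereas points of
   [off_arc] near t0 have cosine above 2 s^2 - 1 > 2 rho^2 - 1. *)
rewrite ess => /(Gamma_half_angle a01)[t1 h1 h2].
have r0 := arc_radius_gt0 a01.
have : cos t0 <= 2 * arc_radius a ^+ 2 - 1.
  have -> : cos t0 = cos t1 by have := congr1 (@complex.Re R) h1.
  have := sqr_cos_half t1.
  have : cos (t1 / 2) ^+ 2 <= arc_radius a ^+ 2; last by lra.
  by rewrite -real_normK ?num_real // ler_pXn2r ?nnegrE ?normr_ge0 ?(ltW r0).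
have s2 : arc_radius a ^+ 2 < s ^+ 2.
  by rewrite ltr_pXn2r ?nnegrE ?(ltW r0) // ltW // (lt_trans r0).
have e0 : 0 < 2 * (s ^+ 2 - arc_radius a ^+ 2) by lra.
have [t [_ [_ ht]] [_ _ hc _]] := near_pt _ e0.
by move: hc; rewrite ltr_norml => /andP[_]; lra.
Unshelve. all: by end_near. Qed.

(** M counts the exceptional points, so it depends on neither n nor r. Each linear factor of [q] has
    squared modulus at most 4 on the circle, hence 4^M, and at least 1 at r >= 3, so [q] does not
    spoil the lower bound there. *)
Lemma exists_trial_polynomial : s < 1 -> exists M : nat, forall n (r : R), 3 <= r ->
  exists P : {poly R[i]}, [/\ (size P <= (n + M).+1)%N,
    sqnorm2 nu P <= 4 ^+ M * (n.+1%:R * s ^+ n) ^+ 2 &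
    (r + (1 - s ^+ 2)) ^+ (2 * n) <= sqnorm P.[r%:C%C]].
Proof.
move=> s1; have s0 : 0 < s by apply: lt_trans s_gt; exact: arc_radius_gt0.
have /finite_seqP[ts hts] := finite_off_arc.
pose q : {poly R[i]} := \prod_(t <- ts) ('X - (expi t)%:P).
exists (size ts) => n r r3; exists (arcpoly s n * q); split.
- rewrite (leq_trans (size_polyMleq _ _)) // size_arcpolyE.
  by rewrite size_prod_XsubC addSn /= addnS.
- apply: int_le_ae.
  + exact: bounded_measurable_horner.
  + by move=> t; exact: sqnorm_ge0.
  + by rewrite mulr_ge0 ?sqr_ge0 // exprn_ge0.
  apply: filterS ae_supp => t st; rewrite hornerM sqnormM mulrC.
  have [hs|hs] := ltP (s ^+ 2) ((1 + cos t) / 2).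
    (* The angle is first moved into [-pi, pi], where [off_arc] lives. *)
    have [t' t'p ht'] := exists_arg (expi t).
    have c1 : cnorm (expi t) = 1 by rewrite /cnorm -/(sqnorm _) sqnorm_expi sqrtr1.
    rewrite c1 mul1r in ht'.
    have : off_arc t'.
      split => //; rewrite -ht'; split => //.
      by have := congr1 (@complex.Re R) ht' => /= <-.
    rewrite hts /= => ht's.
    have -> : q.[expi t] = 0.
      by rewrite /q horner_prod (big_rem t' ht's) /= hornerXsubC ht' subrr mul0r.
    by rewrite sqnorm0 mul0r mulr_ge0 ?sqr_ge0 // exprn_ge0.
  apply: ler_pM; rewrite ?sqnorm_ge0 //.
    rewrite /q horner_prod sqnorm_prod.
    elim: (ts) => [|u us IH]; first by rewrite big_nil expr0.
    rewrite big_cons /= exprS ler_pM ?sqnorm_ge0 //.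
      by rewrite prodr_ge0 // => ? _; exact: sqnorm_ge0.
    rewrite hornerXsubC (le_trans (sqnormD_le _ _)) // sqnormN !sqnorm_expi; lra.
  rewrite sqnorm_arcpoly_expi -(real_normK (num_real (arcU _ _ _))).
  rewrite ler_pXn2r ?nnegrE ?normr_ge0 ?mulr_ge0 ?exprn_ge0 ?(ltW s0) //.
  apply: arcU_bound => //.
  rewrite -(@ler_pXn2r _ 2) ?nnegrE ?normr_ge0 ?(ltW s0) // real_normK ?num_real //.
  by rewrite sqr_cos_half.
- rewrite hornerM sqnormM; apply: le_trans (_ : sqnorm (arcpoly s n).[r%:C%C] <= _).
    by apply: arcpoly_real_lower; lra.
  rewrite ler_peMr ?sqnorm_ge0 // /q horner_prod sqnorm_prod.
  elim: (ts) => [|u us IH]; first by rewrite big_nil.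
  rewrite big_cons mulr_ege1 // hornerXsubC /sqnorm /=.
  have : cos u <= 1 by have := cos_max u; rewrite ler_norml => /andP[].
  have := sqr_ge0 (0 - sin u); nra.
Qed.

End SupportOnArc.

(** * Sequences with vanishing Cesaro means *)

Section CesaroNull.
Variable R : realType.
Implicit Types (u v : nat -> R) (e c : R).

(** One-sided, so that it passes along pointwise upper bounds; for nonnegative sequences it amounts
    to convergence of the means to 0. *)
Definition cesaro_null u :=
  forall e, 0 < e -> \forall N \near \oo, \sum_(j < N) u j <= e * N%:R.

Lemma near_le_lin c e : 0 < e -> \forall N \near \oo, c <= e * N%:R :> R.
Proof.
move=> e0; have := nbhs_infty_ger (c / e); apply: filterS => N /=.
by rewrite ler_pdivrMr // mulrC.
Qed.

Lemma cesaro_null_cvg u : (forall j, 0 <= u j) -> cesaro_null u ->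
  (fun N : nat => N%:R^-1 * \sum_(j < N) u j) @ \oo --> (0 : R).
Proof.
move=> u0 hu; apply/cvgrPdist_le => e e0; near=> N.
have N0 : 0 < N%:R :> R by rewrite ltr0n; near: N; exact: nbhs_infty_gt.
have S0 : 0 <= \sum_(j < N) u j by apply: sumr_ge0.
rewrite sub0r normrN ger0_norm ?mulr_ge0 ?invr_ge0 ?(ltW N0) //.
by rewrite mulrC ler_pdivrMr //; near: N; exact: hu.
Unshelve. all: by end_near. Qed.

Lemma cesaro_null_le u v : (forall j, u j <= v j) -> cesaro_null v -> cesaro_null u.
Proof.
move=> uv hv e e0; apply: filterS (hv e e0) => N; apply: le_trans.
by apply: ler_sum.
Qed.

Lemma cesaro_nullD u v : cesaro_null u -> cesaro_null v ->
  cesaro_null (fun j => u j + v j).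
Proof.
move=> hu hv e e0; have e2 : 0 < e / 2 by lra.
apply: filterS2 (hu _ e2) (hv _ e2) => N h1 h2.
by rewrite big_split /=; lra.
Qed.

Lemma cesaro_nullZ c u : 0 < c -> cesaro_null u -> cesaro_null (fun j => c * u j).
Proof.
move=> c0 hu e e0; apply: filterS (hu _ (divr_gt0 e0 c0)) => N h.
rewrite -mulr_sumr; have : c * \sum_(j < N) u j <= c * (e / c * N%:R) by rewrite ler_pM2l.
by rewrite !mulrA [c * e]mulrC mulfK // gt_eqF.
Qed.

Lemma cesaro_null0 : cesaro_null (fun=> 0).
Proof. by move=> e e0; apply: nearW => N; rewrite big1 // mulr_ge0 // ltW. Qed.

Lemma cesaro_null_sum m (u : nat -> nat -> R) : (forall i, cesaro_null (u i)) ->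
  cesaro_null (fun j => \sum_(1 <= i < m.+1) u i j).
Proof.
move=> hu; elim: m => [|m IH].
  by apply: cesaro_null_le cesaro_null0 => j; rewrite big_geq.
apply: cesaro_null_le (cesaro_nullD IH (hu m.+1)) => j.
by rewrite big_nat_recr.
Qed.

Lemma cesaro_null_shift u c m : (forall j, 0 <= u j <= c) -> cesaro_null u ->
  cesaro_null (fun j => u (j + m)%N).
Proof.
move=> hc; elim: m u hc => [|m IH] u hc hu.
  by apply: cesaro_null_le hu => j; rewrite addn0.
apply: (@cesaro_null_le _ (fun j => u (j + m).+1)) => [j|]; first by rewrite addnS.
apply: (IH (fun j => u j.+1)) => // e e0; have e2 : 0 < e / 2 by lra.
apply: filterS2 (hu _ e2) (near_le_lin c e2) => N h1 h2.
have : \sum_(j < N.+1) u j <= \sum_(j < N) u j + c.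
  by rewrite big_ord_recr /= lerD2l; have /andP[] := hc N.
rewrite big_ord_recl /=.
have -> : \sum_(i < N) u (bump 0 i) = \sum_(j < N) u j.+1 by [].
have /andP[] := hc 0%N; lra.
Qed.

End CesaroNull.

(** The tangent inequality of ln at 1 - y with a quadratic gain, uniform up to x = 1. In terms of p
    = sqrt(1 - x) and q = sqrt(1 - y) the gain is 4 (p - q)^2, at least (p + q)^2 (p - q)^2 because
    p + q <= 2. *)
Lemma ln_strict_concave (R : realType) (x y : R) : 0 <= x < 1 -> 0 <= y < 1 ->
  (x - y) ^+ 2 <= 4 * (y - x) - 4 * (1 - y) * (ln (1 - x) - ln (1 - y)).
Proof.
move=> /andP[x0 x1] /andP[y0 y1].
have [x1' y1'] : 0 < 1 - x /\ 0 < 1 - y by split; lra.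
set p := Num.sqrt (1 - x); set q := Num.sqrt (1 - y).
have p0 : 0 < p by rewrite sqrtr_gt0.
have q0 : 0 < q by rewrite sqrtr_gt0.
have pp : p ^+ 2 = 1 - x by rewrite sqr_sqrtr // ltW.
have qq : q ^+ 2 = 1 - y by rewrite sqr_sqrtr // ltW.
have p1 : p <= 1 by nra.
have q1 : q <= 1 by nra.
have -> : ln (1 - x) - ln (1 - y) = 2 * ln (p / q).
  by rewrite -pp -qq !lnXn // ln_div ?posrE // !mulr2n; lra.
(* [ln t = 2 ln (sqrt t) <= 2 (sqrt t - 1)] keeps a quadratic remainder *)
have h : ln (p / q) <= p / q - 1.
  have := @le_ln1Dx R (p / q - 1); rewrite (_ : 1 + (p / q - 1) = p / q); last by ring.
  by apply; rewrite ltrBrDl subrr divr_gt0.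
have : 4 * (1 - y) * (2 * ln (p / q)) <= 4 * (1 - y) * (2 * (p / q - 1)).
  by rewrite ler_pM2l ?ler_pM2l // mulr_gt0.
have -> : 4 * (1 - y) * (2 * (p / q - 1)) = 8 * q * (p - q).
  by rewrite -qq; field; rewrite gt_eqF.
have -> : x - y = q ^+ 2 - p ^+ 2 by lra.
have -> : y - x = p ^+ 2 - q ^+ 2 by lra.
move: (_ * (2 * _)) => X hX.
have : 4 * (p ^+ 2 - q ^+ 2) - 8 * q * (p - q) = 4 * (p - q) ^+ 2 by ring.
have -> : (q ^+ 2 - p ^+ 2) ^+ 2 = (p + q) ^+ 2 * (p - q) ^+ 2 by ring.
have : (p + q) ^+ 2 <= 4 by nra.
have := sqr_ge0 (p - q); nra.
Qed.

(** * Cesaro asymptotics of the Verblunsky coefficients *)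

Section CesaroNevai.
Variables (R : realType) (a : R) (nu : probability R R) (alpha : nat -> R[i]).
Hypothesis a01 : 0 < a < 1.
Hypothesis orth : verblunsky nu alpha.
Hypothesis ess : ess_supp nu = Gamma a.
Hypothesis reg :
  (fun N : nat => powR (\prod_(j < N) Num.sqrt (1 - cnorm (alpha j) ^+ 2)) N%:R^-1)
    @ \oo --> capacity (Gamma a).
Let rho := arc_radius a.
Let rho_gt0 : 0 < rho := arc_radius_gt0 a01.

Lemma alpha_lt1 j : 0 <= sqnorm (alpha j) < 1.
Proof. by rewrite sqnorm_ge0 sqnorm_lt1 //; exact: orth.1. Qed.

(** This is ln ||Phi_N||^2, by [sqnorm2_szego]. *)
Let ln_sum N : R := \sum_(j < N) ln (1 - sqnorm (alpha j)).

Lemma ln_sumE N : ln_sum N = ln (\prod_(j < N) (1 - sqnorm (alpha j))).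
Proof.
rewrite /ln_sum; elim: N => [|N IH]; first by rewrite !big_ord0 ln1.
rewrite !big_ord_recr /= IH lnM // posrE; last by have := alpha_lt1 N; lra.
by apply: prodr_gt0 => j _; have := alpha_lt1 j; lra.
Qed.

Lemma ln_sum_lower e : 0 < e ->
  \forall N \near \oo, (2 * ln rho - e) * N%:R <= ln_sum N.
Proof.
move=> e0; have h := reg; rewrite capacity_Gamma // in h.
have := cvg_comp _ _ h (continuous_ln rho_gt0).
have e2 : 0 < e / 2 by lra.
move=> /cvgrPdist_le /(_ _ e2) he; near=> N.
have N0 : 0 < N%:R :> R by rewrite ltr0n; near: N; exact: nbhs_infty_gt.
have : `|ln rho - ln (powR (\prod_(j < N) Num.sqrt (1 - cnorm (alpha j) ^+ 2)) N%:R^-1)|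
  <= e / 2 by near: N.
rewrite ln_powR; set L := ln (\prod_(j < N) _) => hL.
have EL : 2 * L = ln_sum N.
  rewrite mulr_natl ln_sumE /L -lnXn.
    rewrite -prodrXl; congr ln; apply: eq_bigr => j _.
    by rewrite sqr_cnorm sqr_sqrtr //; have := alpha_lt1 j; lra.
  apply: prodr_gt0 => j _; rewrite sqrtr_gt0 sqr_cnorm.
  by have := alpha_lt1 j; lra.
move: hL; rewrite -EL ler_norml => /andP[_].
rewrite lerBlDr -lerBlDl => h1.
have : N%:R * (ln rho - e / 2) <= N%:R * (N%:R^-1 * L) by rewrite ler_pM2l.
by rewrite mulrA mulfV ?gt_eqF // mul1r; lra.
Unshelve. all: by end_near. Qed.

(** The logarithm of the two-sided comparison for Phi_N(r), with N = n + M: n is the degree of the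
    arc polynomial, M that of the correcting factor. *)
Lemma szego_Phi_key_bound s : rho < s < 1 -> exists M : nat, forall (r : R) n, 3 <= r ->
  ln (3 / 4) + 2 * n%:R * ln (r + (1 - s ^+ 2)) + ln_sum (n + M) <=
  2 * (n + M)%:R * ln r + 2 / r * (2 + \sum_(j < n + M) cross alpha j)
    + 5 / r ^+ 2 * (n + M)%:R + M%:R * ln 4 + 2 * ln n.+1%:R + 2 * n%:R * ln s.
Proof.
move=> /andP[s_gt s1]; have s0 : 0 < s by exact: lt_trans s_gt.
have [M hM] := exists_trial_polynomial a01 ess s_gt s1.
exists M => r n r3; have [P [sP normP Pr]] := hM n r r3.
set N := (n + M)%N; set b := 1 - s ^+ 2 in Pr *.
have r0 : 0 < r by lra.
have s2 : s ^+ 2 < 1 by rewrite expr_lt1 // ltW.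
have b0 : 0 < r + b by rewrite /b; lra.
have r2 : 2 <= r by lra.
have [X0] := szego_Phi_upper N orth.1 r2.
have := szego_Phi_lower orth r3 sP; rewrite sqnorm2_szego // -/N.
set X := sqnorm _ in X0 *; set E := _ + 5 / r ^+ 2 * _ => lower upper.
set Pi := \prod_(j < N) _ in lower.
have Pi0 : 0 < Pi by apply: prodr_gt0 => j _; have := alpha_lt1 j; lra.
have c0 : (0 : R) < 3 / 4 by lra.
have n0 : 0 < n.+1%:R * s ^+ n :> R by rewrite mulr_gt0 // exprn_gt0.
have q0 : 0 < sqnorm P.[r%:C%C] by apply: lt_le_trans Pr; exact: exprn_gt0.
have chain : 3 / 4 * (r + b) ^+ (2 * n) * Pi <=
    r ^+ (2 * N) * expR E * (4 ^+ M * (n.+1%:R * s ^+ n) ^+ 2).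
  apply: le_trans (_ : 3 / 4 * sqnorm P.[r%:C%C] * Pi <= _).
    by rewrite ler_pM2r // ler_pM2l.
  apply: le_trans lower _; apply: le_trans (_ : X * (4 ^+ M * (n.+1%:R * s ^+ n) ^+ 2) <= _).
    by rewrite ler_pM2l.
  by rewrite ler_pM2r // mulr_gt0 ?exprn_gt0.
have p1 : 0 < (r + b) ^+ (2 * n) by exact: exprn_gt0.
have p2 : 0 < r ^+ (2 * N) by exact: exprn_gt0.
have p3 : (0 : R) < 4 ^+ M by exact: exprn_gt0.
have p4 : 0 < (n.+1%:R * s ^+ n) ^+ 2 by exact: exprn_gt0.
have p5 : 0 < s ^+ n by exact: exprn_gt0.
have eR := expR_gt0 E.
move: chain; rewrite -ler_ln ?posrE ?mulr_gt0 //.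
have lnM_gt0 (x y : R) : 0 < x -> 0 < y -> ln (x * y) = ln x + ln y.
  by move=> x0 y0; rewrite lnM ?posrE.
rewrite (lnM_gt0 _ _ (mulr_gt0 c0 p1) Pi0) (lnM_gt0 _ _ c0 p1).
rewrite (lnM_gt0 _ _ (mulr_gt0 p2 eR) (mulr_gt0 p3 p4)) (lnM_gt0 _ _ p2 eR).
rewrite (lnM_gt0 _ _ p3 p4) expRK !lnXn // (lnM_gt0 _ _ (ltr0Sn R n) p5).
rewrite -ln_sumE (lnXn n s0).
rewrite -[ln (r + b) *+ _]mulr_natl -[ln r *+ _]mulr_natl -[ln 4 *+ _]mulr_natl.
rewrite -[(_ + _) *+ 2]mulr_natl -[ln s *+ _]mulr_natl !natrM /E.
by move: (2 / r * _) (5 / r ^+ 2 * _) => y z; lra.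
Qed.

Lemma ln_offset_lower (r b : R) : 0 < r -> 0 < b -> ln r + b / (r + b) <= ln (r + b).
Proof.
move=> r0 b0; have rb : 0 < r + b by lra.
have h : -1 < - (b / (r + b)) by rewrite ltrN2 ltr_pdivrMr //; lra.
have := le_ln1Dx h; have -> : 1 - b / (r + b) = r / (r + b) by field; rewrite gt_eqF.
by rewrite ln_div ?posrE //; lra.
Qed.

Lemma ratio_offset_lower (r b : R) : 0 < r -> 0 < b -> b < 1 ->
  b - r^-1 <= r * (b / (r + b)).
Proof.
move=> r0 b0 b1; have rb : 0 < r + b by lra.
have -> : r * (b / (r + b)) = b - b ^+ 2 / (r + b) by field; rewrite gt_eqF.
rewrite lerD2l lerN2 ler_pdivrMr // mulrDr mulVf ?gt_eqF //.
have : 0 < r^-1 * b by rewrite mulr_gt0 ?invr_gt0.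
by nra.
Qed.

(** Divided by N and multiplied by r/2, the key bound loses its rates 2 ln s and 2 ln rho up to
    errors in [th] and [d], and leaves r ln(1 + b/r) - 5/(2r) = b + O(1/r). The order of choice is
    r, then [d] and s, then N. *)
Lemma cross_sum_lower e : 0 < e ->
  \forall N \near \oo, (a ^+ 2 - e) * N%:R <= \sum_(j < N) cross alpha j.
Proof.
move=> e0; have rho1 := arc_radius_lt1 a01; rewrite -/rho in rho1.
have rr := sqr_arc_radius a01; rewrite -/rho in rr.
(* The 3 is the threshold of [szego_Phi_lower]. The errors 1/r from [ratio_offset_lower] and 5/(2r)
   add up to 7/(2r) <= e/4. *)
pose r : R := 3 + 14 / e.
have f0 : 0 < 14 / e by rewrite divr_gt0.
have r3 : 3 <= r by rewrite /r; lra.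
have r0 : 0 < r by lra.
have re : 14 <= e * r by rewrite /r mulrDr mulrCA mulfV ?gt_eqF //; lra.
(* Errors in [th] and [d] get multiplied by r, hence the r in the denominator. With the 3 [th] lost
   in b they stay below e/4; the remaining e/2 absorbs [K]. *)
pose d := e / (20 * r).
have d0 : 0 < d by rewrite divr_gt0 // mulr_gt0.
have rd : r * d = e / 20 by rewrite /d; field; rewrite gt_eqF.
pose th := Num.min d ((1 - rho) / 2).
have th0 : 0 < th by rewrite lt_min d0 /=; lra.
have thd : th <= d by rewrite ge_min lexx.
have th1 : th <= (1 - rho) / 2 by rewrite ge_min lexx orbT.
pose s := rho * (1 + th).
have rt : 0 < rho * th < th by rewrite mulr_gt0 //= gtr_pMl.
have s_itv : rho < s < 1 by rewrite /s mulrDr mulr1; apply/andP; split; lra.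
have /andP[s_gt s1] := s_itv; have s0 : 0 < s by exact: lt_trans s_gt.
have ls : ln s <= ln rho + th.
  by rewrite /s lnM ?posrE ?lerD2l ?le_ln1Dx //; lra.
have [M hM] := szego_Phi_key_bound s_itv.
pose b := 1 - s ^+ 2.
have b0 : 0 < b by rewrite /b subr_gt0 expr_lt1 // ltW.
have ba : a ^+ 2 - 3 * th <= b.
  have -> : b = 1 - rho ^+ 2 * (1 + th) ^+ 2 by rewrite /b /s exprMn.
  have : 0 < rho ^+ 2 < 1 by rewrite rr; have /andP[a0 a1] := a01; nra.
  have : (1 + th) ^+ 2 <= 1 + 3 * th by nra.
  have : a ^+ 2 = 1 - rho ^+ 2 by lra.
  move=> ->; move: (rho ^+ 2) (_ ^+ 2) => u v; nra.
have b1 : b < 1 by rewrite /b; have := exprn_gt0 2 s0; lra.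
pose lb := ln (r + b).
have lbr : ln r + b / (r + b) <= lb by exact: ln_offset_lower.
(* Everything in the key bound that does not grow with N, including the constants of the linear
   bound on ln(N - M + 1). *)
pose K := ln (3 / 4) - 2 * M%:R * (lb - ln s) - 4 / r - M%:R * ln 4 - 2 * d + 2 * ln d.
near=> N.
have MN : (M <= N)%N by near: N; exact: nbhs_infty_ge.
have hL : (2 * ln rho - d) * N%:R <= ln_sum N by near: N; exact: ln_sum_lower.
have hK : - (r / 2 * K) <= e / 2 * N%:R by near: N; apply: near_le_lin; lra.
have := hM r (N - M)%N r3; rewrite subnK // natrB // -/b -/lb.
have := ln_le_lin d0 (ltr0Sn R (N - M)).
have : (N - M).+1%:R <= N%:R + 1 :> R by rewrite natr1 ler_nat ltnS leq_subr.
set C := \sum_(j < N) _; set Ln := ln (N - M).+1%:R; set n1 : R := (N - M).+1%:R.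
have N0 : 0 <= N%:R :> R by [].
move: hL hK; move: (ln_sum N) (N%:R : R) N0 => L x x0 hL hK hn1 hLn key.
have hLn' : Ln <= d * (x + 1) - ln d.
  by apply: le_trans hLn _; rewrite lerD2r ler_pM2l.
have x_lb : x * (ln r + b / (r + b)) <= x * lb by rewrite ler_wpM2l.
have x_ls : x * ln s <= x * (ln rho + th) by rewrite ler_wpM2l.
have step : x * (2 * (b / (r + b)) - 2 * th - 3 * d - 5 / r ^+ 2) + K <= 2 / r * C.
  rewrite /K; move: (b / (r + b)) x_lb x_ls (5 / r ^+ 2) key => B x_lb x_ls F key.
  have E4 : 2 / r * (2 + C) = 4 / r + 2 / r * C by field; rewrite gt_eqF.
  rewrite E4 in key; move: (2 / r * C) (4 / r) key => Y Z key.
  by clear - key hL hLn' x_lb x_ls; lra.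
have : r / 2 * (x * (2 * (b / (r + b)) - 2 * th - 3 * d - 5 / r ^+ 2) + K) <= r / 2 * (2 / r * C).
  by rewrite ler_pM2l // divr_gt0.
have -> : r / 2 * (2 / r * C) = C by field; rewrite gt_eqF.
apply: le_trans.
have rb := ratio_offset_lower r0 b0 b1.
have ir : r^-1 <= e / 14.
  by rewrite -[r^-1]mul1r ler_pdivrMr // mulrAC ler_pdivlMr // mul1r.
have -> : r / 2 * (x * (2 * (b / (r + b)) - 2 * th - 3 * d - 5 / r ^+ 2) + K) =
    x * (r * (b / (r + b)) - r * th - 3 / 2 * (r * d) - 5 / 2 * r^-1) + r / 2 * K.
  by move: (b / (r + b)) => B; field; rewrite gt_eqF.
have rth : r * th <= e / 20 by rewrite -rd ler_pM2l.
have th3 : 3 * th <= e / 20 by rewrite (le_trans _ rth) // ler_pM2r.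
have : x * (a ^+ 2 - e / 2) <=
    x * (r * (b / (r + b)) - r * th - 3 / 2 * (r * d) - 5 / 2 * r^-1).
  rewrite ler_wpM2l // rd; move: (r * _) (r * th) (r^-1) rb rth ir => B T I rb rth ir.
  by clear - e0 ba th3 rb rth ir; lra.
by move: (x * (_ - _ - _ - _)) (r / 2 * K) hK => Y Z hK; lra.
Unshelve. all: by end_near. Qed.

Let abs_sum N : R := \sum_(j < N) sqnorm (alpha j).

Lemma abs_sum_shift N : \sum_(j < N) sqnorm (alpha j.+1) <= abs_sum N + 1.
Proof.
have /andP[h0 _] := alpha_lt1 0; have /andP[_ /ltW h1] := alpha_lt1 N.
have : \sum_(j < N.+1) sqnorm (alpha j) <= abs_sum N + 1.
  by rewrite big_ord_recr /= lerD2l.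
rewrite big_ord_recl /=.
have -> : \sum_(i < N) sqnorm (alpha (bump 0 i)) = \sum_(j < N) sqnorm (alpha j.+1) by [].
lra.
Qed.

Lemma sum_sqnorm_sub N : \sum_(j < N) sqnorm (alpha j.+1 - alpha j) =
  \sum_(j < N) sqnorm (alpha j.+1) + abs_sum N - 2 * \sum_(j < N) cross alpha j.
Proof.
rewrite /abs_sum mulr_sumr -big_split -sumrB /=; apply: eq_bigr => j _.
by rewrite /cross /sqnorm; case: (alpha j) (alpha j.+1) => [? ?] [? ?] /=; ring.
Qed.

Lemma cross_sum_le N : 2 * \sum_(j < N) cross alpha j <= 2 * abs_sum N + 1.
Proof.
have : 0 <= \sum_(j < N) sqnorm (alpha j.+1 - alpha j).
  by apply: sumr_ge0 => j _; exact: sqnorm_ge0.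
rewrite sum_sqnorm_sub; have := abs_sum_shift N; lra.
Qed.

Lemma sqnorm_deviation_sum N :
  \sum_(j < N) (sqnorm (alpha j) - a ^+ 2) ^+ 2 <=
  4 * (a ^+ 2 * N%:R - abs_sum N)
    - 4 * (1 - a ^+ 2) * (ln_sum N - 2 * ln rho * N%:R).
Proof.
have /andP[a0 a1] := a01.
have lr : ln (1 - a ^+ 2) = 2 * ln rho.
  by rewrite -(sqr_arc_radius a01) lnXn // mulr_natl.
rewrite /abs_sum /ln_sum.
elim: N => [|N IH]; first by rewrite !big_ord0; lra.
rewrite !big_ord_recr /= -natr1.
have := @ln_strict_concave R (sqnorm (alpha N)) (a ^+ 2) (alpha_lt1 N).
rewrite sqr_ge0 expr_lt1 ?(ltW a0) // => /(_ a1); rewrite lr.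
lra.
Qed.

Lemma scaled_lower (b x y : R) : 0 < b <= 1 -> 0 <= y -> - y <= x -> - y <= b * x.
Proof.
move=> /andP[b0 b1] y0 xy; have : 0 <= b * (x + y) by apply: mulr_ge0; lra.
have : b * y <= y by rewrite ler_piMl.
lra.
Qed.

(** From below, nonnegativity of |alpha_(j+1) - alpha_j|^2 makes the correlations at most the
    squared moduli, up to a boundary term. From above, the left side of [sqnorm_deviation_sum] is
    nonnegative and [ln_sum] is at least 2 N ln rho - o(N). *)
Lemma abs_sum_near e : 0 < e -> \forall N \near \oo,
  (a ^+ 2 - e) * N%:R <= abs_sum N <= (a ^+ 2 + e) * N%:R.
Proof.
move=> e0; have e2 : 0 < e / 2 by lra.
have /andP[a0 a1] := a01.
have a2 : 0 < 1 - a ^+ 2 <= 1.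
  by rewrite subr_gt0 expr_lt1 ?(ltW a0) // a1 /= gerBl sqr_ge0.
near=> N; have N0 : 0 <= N%:R :> R by [].
have h1 : (a ^+ 2 - e / 2) * N%:R <= \sum_(j < N) cross alpha j.
  by near: N; exact: cross_sum_lower.
have h2 : 1 <= e / 2 * N%:R by near: N; exact: near_le_lin.
have h3 : (2 * ln rho - e) * N%:R <= ln_sum N by near: N; exact: ln_sum_lower.
have h4 := cross_sum_le N.
have h5 := sqnorm_deviation_sum N.
have h6 : 0 <= \sum_(j < N) (sqnorm (alpha j) - a ^+ 2) ^+ 2.
  by apply: sumr_ge0 => j _; exact: sqr_ge0.
have h7 : - (e * N%:R) <= (1 - a ^+ 2) * (ln_sum N - 2 * ln rho * N%:R).
  by apply: scaled_lower => //; [rewrite mulr_ge0 // ltW|lra].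
apply/andP; split; first by lra.
rewrite -[4 * _ * _]mulrA in h5; move: h7 h5; move: ((1 - a ^+ 2) * _) => X; lra.
Unshelve. all: by end_near. Qed.

Lemma cesaro_null_sqnorm_deviation :
  cesaro_null (fun j => (sqnorm (alpha j) - a ^+ 2) ^+ 2).
Proof.
move=> e e0; have e8 : 0 < e / 8 by lra.
have /andP[a0 a1] := a01.
have a2 : 0 < 1 - a ^+ 2 <= 1.
  by rewrite subr_gt0 expr_lt1 ?(ltW a0) // a1 /= gerBl sqr_ge0.
near=> N; have N0 : 0 <= N%:R :> R by [].
have /andP[h1 _] : (a ^+ 2 - e / 8) * N%:R <= abs_sum N <= (a ^+ 2 + e / 8) * N%:R.
  by near: N; exact: abs_sum_near.
have h3 : (2 * ln rho - e / 8) * N%:R <= ln_sum N by near: N; exact: ln_sum_lower.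
apply: le_trans (sqnorm_deviation_sum N) _.
have h7 : - (e / 8 * N%:R) <= (1 - a ^+ 2) * (ln_sum N - 2 * ln rho * N%:R).
  by apply: scaled_lower => //; [rewrite mulr_ge0 // ltW|lra].
rewrite -[4 * _ * _]mulrA; move: h7; move: ((1 - a ^+ 2) * _) => X; lra.
Unshelve. all: by end_near. Qed.

(** Since |alpha_j| + a >= a > 0, the deviation of the modulus is at most 1/a times that of its
    square. *)
Lemma cesaro_null_modulus : cesaro_null (fun j => (cnorm (alpha j) - a) ^+ 2).
Proof.
have /andP[a0 a1] := a01; have ia : 0 < (a ^+ 2)^-1 by rewrite invr_gt0 exprn_gt0.
apply: cesaro_null_le (cesaro_nullZ ia cesaro_null_sqnorm_deviation) => j.
rewrite ler_pdivlMl ?exprn_gt0 // -sqr_cnorm.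
have c0 := cnorm_ge0 (alpha j).
have -> : (cnorm (alpha j) ^+ 2 - a ^+ 2) ^+ 2 =
  (cnorm (alpha j) + a) ^+ 2 * (cnorm (alpha j) - a) ^+ 2 by ring.
rewrite ler_wpM2r ?sqr_ge0 //; nra.
Qed.

Lemma cesaro_null_increment : cesaro_null (fun j => cnorm (alpha j.+1 - alpha j) ^+ 2).
Proof.
move=> e e0; have e8 : 0 < e / 8 by lra.
near=> N.
have /andP[_ h1] : (a ^+ 2 - e / 8) * N%:R <= abs_sum N <= (a ^+ 2 + e / 8) * N%:R.
  by near: N; exact: abs_sum_near.
have h2 : (a ^+ 2 - e / 8) * N%:R <= \sum_(j < N) cross alpha j.
  by near: N; exact: cross_sum_lower.
have h3 : 1 <= e / 8 * N%:R by near: N; exact: near_le_lin.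
under eq_bigr do rewrite sqr_cnorm.
rewrite sum_sqnorm_sub; have := abs_sum_shift N; lra.
Unshelve. all: by end_near. Qed.

Lemma cesaro_null_increments m :
  cesaro_null (fun j => sqnorm (alpha (j + m)%N - alpha j)).
Proof.
elim: m => [|m IH].
  apply: cesaro_null_le (@cesaro_null0 R) => j.
  by rewrite addn0 subrr sqnorm0.
have bnd j : 0 <= cnorm (alpha j.+1 - alpha j) ^+ 2 <= 4.
  rewrite sqr_ge0 sqr_cnorm /= (le_trans (sqnormD_le _ _)) // sqnormN.
  by have := alpha_lt1 j; have := alpha_lt1 j.+1; lra.
have h := @cesaro_null_shift _ _ _ m bnd cesaro_null_increment.
have two : (0 : R) < 2 by [].
apply: cesaro_null_le (cesaro_nullZ two (cesaro_nullD h IH)) => j.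
rewrite sqr_cnorm mulrDr addnS (le_trans _ (sqnormD_le _ _)) //.
by rewrite (_ : _ - _ + _ = alpha (j + m).+1 - alpha j) //; ring.
Qed.

Lemma sqnorm_arc_deviation j t : alpha j = (cnorm (alpha j))%:C%C * expi t ->
  sqnorm (alpha j - Complex a 0 * expi t) = (cnorm (alpha j) - a) ^+ 2.
Proof.
move=> h; have -> : alpha j - Complex a 0 * expi t = (cnorm (alpha j) - a)%:C%C * expi t.
  by rewrite {1}h rmorphB mulrBl.
by rewrite sqnormM sqnorm_expi mulr1 /sqnorm /= expr0n addr0.
Qed.

(** The summand of (c): the infimum of a continuous periodic function of t, hence its minimum. *)
Definition arc_dist k j : R := inf [set s : R | exists t : R,
  s = \sum_(1 <= m < k.+1) cnorm (alpha (j + m)%N - Complex a 0 * expi t) ^+ 2].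

Lemma arc_dist_ge0 k j : 0 <= arc_dist k j.
Proof.
apply: lb_le_inf; first by eexists; exists 0; reflexivity.
by move=> _ [t ->]; apply: sumr_ge0 => m _; exact: sqr_ge0.
Qed.

(* Compare with the point of the circle of radius a in the direction of alpha_j. *)
Lemma arc_dist_le k j : arc_dist k j <= \sum_(1 <= m < k.+1)
  2 * (sqnorm (alpha (j + m)%N - alpha j) + (cnorm (alpha j) - a) ^+ 2).
Proof.
have [t _ ht] := exists_arg (alpha j).
apply: le_trans (_ : \sum_(1 <= m < k.+1)
    cnorm (alpha (j + m)%N - Complex a 0 * expi t) ^+ 2 <= _).
  apply: ge_inf; last by exists t.
  exists 0 => _ [u ->]; apply: sumr_ge0 => m _; exact: sqr_ge0.
apply: ler_sum => m _; rewrite sqr_cnorm -(sqnorm_arc_deviation ht) mulrDr.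
apply: le_trans (sqnormD_le _ _).
by rewrite (_ : _ - _ + _ = alpha (j + m)%N - Complex a 0 * expi t) //; ring.
Qed.

Lemma cesaro_null_arc_dist k : cesaro_null (arc_dist k).
Proof.
have two : (0 : R) < 2 by [].
apply: cesaro_null_le (arc_dist_le k) _.
apply: cesaro_null_sum => m; apply: cesaro_nullZ => //.
by apply: cesaro_nullD; [exact: cesaro_null_increments|exact: cesaro_null_modulus].
Qed.

End CesaroNevai.

Theorem theorem4p2 (R : realType) (a : R) (nu : probability R R) (alpha : nat -> R[i]) :
  0 < a < 1 ->
  nontrivial nu ->
  verblunsky nu alpha ->
  ess_supp nu = Gamma a ->
  (fun N : nat => powR (\prod_(j < N) Num.sqrt (1 - cnorm (alpha j) ^+ 2)) N%:R^-1)
    @ \oo --> capacity (Gamma a) ->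
  [/\ (fun N : nat => N%:R^-1 * \sum_(j < N) (cnorm (alpha j) - a) ^+ 2) @ \oo --> (0 : R),
      (fun N : nat => N%:R^-1 * \sum_(j < N) cnorm (alpha j.+1 - alpha j) ^+ 2) @ \oo --> (0 : R)
    & forall k : nat, (0 < k)%N ->
      (fun N : nat => N%:R^-1 * \sum_(j < N)
          inf [set s : R | exists t : R,
                 s = \sum_(1 <= m < k.+1) cnorm (alpha (j + m)%N - Complex a 0 * expi t) ^+ 2])
        @ \oo --> (0 : R)].
Proof.
move=> a01 _ orth ess reg; split=> [||k _].
- exact: (cesaro_null_cvg (fun j => sqr_ge0 _) (cesaro_null_modulus a01 orth ess reg)).
- exact: (cesaro_null_cvg (fun j => sqr_ge0 _) (cesaro_null_increment a01 orth ess reg)).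
- exact: (cesaro_null_cvg (arc_dist_ge0 a alpha k) (cesaro_null_arc_dist a01 orth ess reg k)).
Qed.
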